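(* For any weak composition $a$ of length $n$, \[ \overline{\mathfrak{Q}}_a^{(\beta)}=\sum_{S\in\overline{\mathfrak{Q}}2\overline{\mathfrak{F}}(a)}\beta^{|S|-|a|}\,\overline{\mathfrak{F}}_{\mathrm{wt}(S)}^{(\beta)}, \] where $\overline{\mathfrak{Q}}2\overline{\mathfrak{F}}(a)$ is the set of quasiYamanouchi set-valued quasi-skyline fillings of shape $a$. In particular, every quasiLascoux polynomial $\overline{\mathfrak{Q}}_a^{(\beta)}$ is a positive sum of glide polynomials.
   Context: Fix $n\ge1$; $\beta$ is a formal parameter. A weak composition of length $n$ is a sequence $a=(a_1,\dots,a_n)$ of nonnegative integers, $|a|=\sum_i a_i$, and $\mathbf{x}^a=x_1^{a_1}\cdots x_n^{a_n}$. The positive part $a^+$ is the sequence obtained by deleting all zeros of $a$. $b\ge a$ means $b_1+\dots+b_i\ge a_1+\dots+a_i$ for all $1\le i\le n$. The skyline diagram $D(a)$ has $a_i$ left-justified boxes in row $i$; row $1$ is the lowest row. A triple consists of three boxes, two of them adjacent in a row (left box with entry $\beta'$, right box with entry $\alpha'$) and a third box with entry $\gamma'$, such that either (Type A) the third box is above the right box, in the same column as it, and the lower of the two rows is weakly longer, or (Type B) the third box is below the left box, in the same column as it, and the higher of the two rows is strictly longer. A triple is an inversion triple if $\gamma'<\alpha'\le\beta'$ or $\alpha'\le\beta'<\gamma'$. A set-valued filling assigns a nonempty set of positive integers to each box; the maximum of each box is its anchor, all other entries are free. Consider the conditions (S.1) entries do not repeat in a column; (S.2) rows are weakly decreasing from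 left to right, where $A\ge B$ means $\min A\ge\max B$; (S.3) every triple of anchors is an inversion triple; (S.4) each free entry is in the cell of the least anchor in its column such that (S.2) is not violated (i.e. among the cells of its column with larger anchor in which it could be placed without violating (S.2), it is in the one with least anchor); (S.5) anchors in the first column equal their row index; (S.5$'$) anchors in the first column are at most their row index and decrease from top to bottom. $\overline{\mathfrak{A}}\mathsf{SSF}(a)$ is the set of set-valued fillings of $D(a)$ satisfying (S.1)--(S.5). $\overline{\mathfrak{Q}}\mathsf{SSF}(a)$, the set-valued quasi-skyline fillings of shape $a$, is the set of set-valued fillings of $D(a)$ satisfying (S.1)--(S.4) and (S.5$'$). For a filling $F$, $\mathrm{wt}(F)=(c_1,\dots,c_n)$ with $c_i$ the number of $i$'s in $F$, $|F|=|\mathrm{wt}(F)|$, and $\mathrm{ex}(F)=|F|-|a|$ is the number of free entries. The Lascoux atom is $\overline{\mathfrak{A}}_a^{(\beta)}=\sum_{F\in\overline{\mathfrak{A}}\mathsf{SSF}(a)}\beta^{\mathrm{ex}(F)}\mathbf{x}^{\mathrm{wt}(F)}$, and the quasiLascoux polynomial is $\overline{\mathfrak{Q}}_a^{(\beta)}=\sum_{b\ge a,\ b^+=a^+}\overline{\mathfrak{A}}_b^{(\beta)}$, the sum over weak compositions $b$ of length $n$. QuasiYamanouchi. $S\in\overline{\mathfrak{Q}}\mathsf{SSF}(a)$ is quasiYamanouchi if, for every integer $i$ appearing in $S$, either the leftmost $i$ is an anchor in row $i$ of the leftmost column, or there is an $i+1$ in some column weakly right of the leftmost $i$ and in a different box.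 Glide polynomials. A weak komposition is a weak composition whose positive entries are each colored black or red (different colorings are different weak kompositions); its excess $\mathrm{ex}$ is the number of red entries. Let $a$ have nonzero entries exactly in positions $n_1<\dots<n_\ell$. A weak komposition $b$ of length $n$ is a glide of $a$ if there exist integers $0=i_0<i_1<\dots<i_\ell$ such that $b_k=0$ for $k>i_\ell$ and, for each $1\le j\le\ell$: $a_{n_j}=b_{i_{j-1}+1}+\dots+b_{i_j}-\mathrm{ex}(b_{i_{j-1}+1},\dots,b_{i_j})$; $i_j\le n_j$; and the leftmost nonzero entry among $b_{i_{j-1}+1},\dots,b_{i_j}$ is black. The glide polynomial is $\overline{\mathfrak{F}}_a^{(\beta)}=\sum_b\beta^{\mathrm{ex}(b)}\mathbf{x}^b$ over all glides $b$ of $a$. *)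

(* Defs.v *)
(* MathComp, with multinomials for polynomials in x_1, ..., x_n.

   Rows, entries and variables, numbered 1, ..., n in the mathematics, are all
   elements of 'I_n, i.e. numbered 0, ..., n-1; the same shift applies to all
   three, so comparing an entry with a row needs no correction.  Row 0 is the
   lowest row.  Columns are numbered from 0. *)
From HB Require Import structures.
From mathcomp Require Import all_boot all_order all_algebra.
From mathcomp Require Import mpoly.

Set Implicit Arguments.
Unset Strict Implicit.
Unset Printing Implicit Defensive.

Import GRing.Theory Num.Theory.
Local Open Scope ring_scope.

(* A weak composition a of length n is a : 'X_{1..n}, with |a| = mdeg a and
   x^a = 'X_[a]. *)

Definition pos_part (n : nat) (a : 'X_{1..n}) : seq nat :=
  [seq m <- [seq a i | i <- enum 'I_n] | m != 0%N].

Definition wc_ge (n : nat) (b a : 'X_{1..n}) : bool :=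
  [forall k : 'I_n,
     (\sum_(i < n | i <= k) a i <= \sum_(i < n | i <= k) b i)%N].

Definition beta : {poly int} := 'X.

Definition cell (n : nat) (a : 'X_{1..n}) := {i : 'I_n & 'I_(a i)}.

Definition row (n : nat) (a : 'X_{1..n}) (c : cell a) : 'I_n := tag c.

Definition col (n : nat) (a : 'X_{1..n}) (c : cell a) : nat :=
  nat_of_ord (tagged c).

(* Entries may be taken in {1, ..., n} because every filling used below has
   only such entries: (S.5) or (S.5') bounds the anchors of the first column by
   n, and (S.2) then bounds everything to their right. *)
Definition filling (n : nat) (a : 'X_{1..n}) := {ffun cell a -> {set 'I_n}}.

Definition is_filling (n : nat) (a : 'X_{1..n}) (F : filling a) : bool :=
  [forall c, F c != set0].

Definition anchor (n : nat) (a : 'X_{1..n}) (F : filling a) (c : cell a) : nat :=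
  (\max_(x in F c) x)%N.

Definition free_entry (n : nat) (a : 'X_{1..n}) (F : filling a) (c : cell a)
    (x : 'I_n) : bool :=
  (x \in F c) && (nat_of_ord x != anchor F c).

Definition S1 (n : nat) (a : 'X_{1..n}) (F : filling a) : bool :=
  [forall c, forall d, (col c == col d) && (c != d) ==> [disjoint F c & F d]].

Definition adjacent (n : nat) (a : 'X_{1..n}) (l r : cell a) : bool :=
  (row l == row r) && (col r == (col l).+1).

Definition S2 (n : nat) (a : 'X_{1..n}) (F : filling a) : bool :=
  [forall l, forall r, adjacent l r ==>
     [forall x in F l, forall y in F r, (y <= x)%N]].

Definition typeA (n : nat) (a : 'X_{1..n}) (l r t : cell a) : bool :=
  [&& adjacent l r, (row r < row t)%N, col t == col r &
      (a (row t) <= a (row r))%N].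

Definition typeB (n : nat) (a : 'X_{1..n}) (l r t : cell a) : bool :=
  [&& adjacent l r, (row t < row l)%N, col t == col l &
      (a (row t) < a (row l))%N].

Definition inversion (be al ga : nat) : bool :=
  (ga < al <= be)%N || (al <= be < ga)%N.

Definition S3 (n : nat) (a : 'X_{1..n}) (F : filling a) : bool :=
  [forall l, forall r, forall t, typeA l r t || typeB l r t ==>
     inversion (anchor F l) (anchor F r) (anchor F t)].

Definition move_entry (n : nat) (a : 'X_{1..n}) (F : filling a) (x : 'I_n)
    (c d : cell a) : filling a :=
  [ffun e => if e == d then x |: F e else if e == c then F e :\ x else F e].

Definition S4 (n : nat) (a : 'X_{1..n}) (F : filling a) : bool :=
  [forall c, forall x, free_entry F c x ==>
     [forall d, [&& col d == col c, (x < anchor F d)%N &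
                    S2 (move_entry F x c d)]
                ==> (anchor F c <= anchor F d)%N]].

Definition S5 (n : nat) (a : 'X_{1..n}) (F : filling a) : bool :=
  [forall c, (col c == 0%N) ==> (anchor F c == row c)].

Definition S5' (n : nat) (a : 'X_{1..n}) (F : filling a) : bool :=
  [forall c, (col c == 0%N) ==> (anchor F c <= row c)%N] &&
  [forall c, forall d, [&& col c == 0%N, col d == 0%N & (row c < row d)%N]
                       ==> (anchor F c < anchor F d)%N].

Definition ASSF (n : nat) (a : 'X_{1..n}) : {set filling a} :=
  [set F : filling a | [&& is_filling F, S1 F, S2 F, S3 F, S4 F & S5 F]].

Definition QSSF (n : nat) (a : 'X_{1..n}) : {set filling a} :=
  [set F : filling a | [&& is_filling F, S1 F, S2 F, S3 F, S4 F & S5' F]].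

Definition wt (n : nat) (a : 'X_{1..n}) (F : filling a) : 'X_{1..n} :=
  [multinom #|[set c | i \in F c]| | i < n].

(* The subtraction does not truncate: boxes of a set-valued filling are
   nonempty. *)
Definition ex_filling (n : nat) (a : 'X_{1..n}) (F : filling a) : nat :=
  (mdeg (wt F) - mdeg a)%N.

Definition lascoux_atom (n : nat) (a : 'X_{1..n}) : {mpoly {poly int}[n]} :=
  \sum_(F in ASSF a) beta ^+ ex_filling F *: 'X_[wt F].

(* The degree bound on b is no restriction: b^+ = a^+ forces |b| = |a|. *)
Definition quasiLascoux (n : nat) (a : 'X_{1..n}) : {mpoly {poly int}[n]} :=
  \sum_(b : 'X_{1..n < (mdeg a).+1} |
          wc_ge b a && (pos_part b == pos_part a)) lascoux_atom b.

(* By (S.1) the leftmost i lies in a single cell. *)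
Definition leftmost (n : nat) (a : 'X_{1..n}) (F : filling a) (i : 'I_n)
    (c : cell a) : bool :=
  (i \in F c) && [forall d, (i \in F d) ==> (col c <= col d)%N].

Definition quasiYamanouchi (n : nat) (a : 'X_{1..n}) (F : filling a) : bool :=
  [forall i, forall c, leftmost F i c ==>
     [&& col c == 0%N, row c == i & anchor F c == i] ||
     [exists d, exists j : 'I_n,
        [&& nat_of_ord j == i.+1, j \in F d, (col c <= col d)%N & d != c]]].

Definition Q2F (n : nat) (a : 'X_{1..n}) : {set filling a} :=
  [set S in QSSF a | quasiYamanouchi S].

(* A weak komposition is a weak composition b with the set R of the positions
   of its red entries; its excess is #|R|. *)
Definition is_komposition (n : nat) (b : 'X_{1..n}) (R : {set 'I_n}) : bool :=
  [forall k in R, (0 < b k)%N].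

Definition nz_positions (n : nat) (a : 'X_{1..n}) : seq 'I_n :=
  [seq i <- enum 'I_n | a i != 0%N].

(* Positions p < k <= q in 1-based numbering. *)
Definition block (n : nat) (p q : nat) : {set 'I_n} :=
  [set k : 'I_n | (p <= k < q)%N].

(* The equation a_{n_j} = (sum of b) - ex is stated as (sum of b) = a_{n_j} + ex
   to avoid truncated subtraction. *)
Definition glide_block (n : nat) (a b : 'X_{1..n}) (R : {set 'I_n})
    (nj : 'I_n) (B : {set 'I_n}) : bool :=
  (\sum_(k in B) b k == a nj + #|R :&: B|)%N &&
  [forall k in B,
     (b k != 0%N) && [forall k' in B, (k' < k)%N ==> (b k' == 0%N)]
     ==> (k \notin R)].

(* cut j stands for i_j; nj, an element of 'I_n, is n_j - 1. *)
Definition glide_cuts (n : nat) (a b : 'X_{1..n}) (R : {set 'I_n})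
    (cut : nat -> nat) : bool :=
  let pos := nz_positions a in
  [&& cut 0%N == 0%N,
      [forall k : 'I_n, (cut (size pos) <= k)%N ==> (b k == 0%N)] &
      [forall j : 'I_(size pos),
         let nj := tnth (in_tuple pos) j in
         [&& (cut j < cut j.+1)%N, (cut j.+1 <= nj.+1)%N &
             glide_block a b R nj (block n (cut j) (cut j.+1))]]].

(* The cut points are at most n because i_j <= n_j <= n. *)
Definition is_glide (n : nat) (a b : 'X_{1..n}) (R : {set 'I_n}) : bool :=
  is_komposition b R &&
  [exists s : (size (nz_positions a)).+1.-tuple 'I_n.+1,
     glide_cuts a b R (fun j => nth ord0 s j)].

(* The degree bound on b is no restriction: a glide b of a satisfies
   |b| = |a| + ex(b), and ex(b) <= n. *)
Definition glide_poly (n : nat) (a : 'X_{1..n}) : {mpoly {poly int}[n]} :=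
  \sum_(b : 'X_{1..n < (mdeg a + n).+1})
    \sum_(R : {set 'I_n} | is_glide a b R) beta ^+ #|R| *: 'X_[b].

(* Main.v *)
(* Summing the atoms of the b >= a with b^+ = a^+ amounts to summing over all
   quasi-skyline fillings T of shape a: slide each row of T to the row named by
   its first anchor.

   Conditions (S.1)-(S.4) depend only on the order of the entries of T, read by
   value and, for equal values, from right to left.  A map f on values
   "coarsens" T if it is weakly increasing and two values it merges satisfy:
   every occurrence of the larger one lies in the same box as, or strictly left
   of, every occurrence of the smaller one.  Applying such an f preserves
   (S.1)-(S.4) in both directions.  A coarsening that is maximal subject to
   (S.5') has a quasiYamanouchi image, and it is the only one that does, so each
   T destandardizes to exactly one quasiYamanouchi S = f(T).

   The fibre over S is parametrized by the glides of wt(S): the komposition of T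
   is wt(T), with a value k red when some box holds both k and a smaller value
   of its class.  Conversely a glide cuts the reading order of the entries of S
   into consecutive intervals, two of which overlap in one entry exactly when
   the second is red; relabelling the entries by their intervals gives T. *)

Require Import Defs.
From HB Require Import structures.
From mathcomp Require Import all_boot all_order all_algebra.
From mathcomp Require Import mpoly.
From mathcomp Require Import zify.
(* Shadows [row] and [col] of mathcomp's matrix.v. *)
Import Defs.

Set Implicit Arguments.
Unset Strict Implicit.
Unset Printing Implicit Defensive.

Import GRing.Theory Num.Theory.
Local Open Scope ring_scope.

(** * Elementwise forms of the conditions on fillings *)

Section Fillings.

Variables (n : nat) (a : 'X_{1..n}).
Implicit Types (F S T : filling a) (c d l r t : cell a) (x y : 'I_n).

Lemma is_fillingP F : reflect (forall c, exists x, x \in F c) (is_filling F).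
Proof.
apply: (iffP forallP) => h c; first exact/set0Pn.
by apply/set0Pn; apply: h.
Qed.

Lemma leq_anchor F c x : x \in F c -> (x <= anchor F c)%N.
Proof. by move=> xF; rewrite /anchor (bigD1 x) //= leq_maxl. Qed.

Lemma anchor_mem F c :
  is_filling F -> exists2 x, x \in F c & anchor F c = x.
Proof.
move=> /is_fillingP/(_ c)[x0 x0F].
have [|x xF e] := @eq_bigmax_cond _ (mem (F c)) (fun i : 'I_n => i : nat).
  by apply/card_gt0P; exists x0.
by exists x.
Qed.

Lemma anchor_eq F c x :
  x \in F c -> (forall y, y \in F c -> (y <= x)%N) -> anchor F c = x.
Proof.
move=> xF xmax; apply/eqP; rewrite eqn_leq leq_anchor // andbT.
by apply/bigmax_leqP.
Qed.

Lemma S1P F :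
  reflect (forall c d x, col c = col d -> x \in F c -> x \in F d -> c = d)
          (S1 F).
Proof.
rewrite /S1; apply: (iffP idP) => [h c d x ecd xc xd | h].
  apply/eqP; apply/negPn/negP => ncd.
  move/forallP: h => /(_ c)/forallP/(_ d)/implyP.
  rewrite ecd eqxx ncd => /(_ isT) /disjointFr /(_ xc).
  by rewrite xd.
apply/forallP => c; apply/forallP => d; apply/implyP => /andP[/eqP ecd ncd].
apply/pred0P => x /=; apply/negbTE/negP => /andP[xc xd].
by move: ncd; rewrite (h _ _ _ ecd xc xd) eqxx.
Qed.

Lemma S2P F :
  reflect (forall l r x y, adjacent l r -> x \in F l -> y \in F r ->
             (y <= x)%N) (S2 F).
Proof.
rewrite /S2; apply: (iffP idP) => [h l r x y adj xl yr | h].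
  move/forallP: h => /(_ l)/forallP/(_ r)/implyP/(_ adj).
  by move=> /forallP/(_ x)/implyP/(_ xl)/forallP/(_ y)/implyP/(_ yr).
apply/forallP => l; apply/forallP => r; apply/implyP => adj.
apply/forallP => x; apply/implyP => xl; apply/forallP => y; apply/implyP => yr.
exact: h adj xl yr.
Qed.

Lemma S3P F :
  reflect (forall l r t, typeA l r t || typeB l r t ->
             inversion (anchor F l) (anchor F r) (anchor F t)) (S3 F).
Proof.
rewrite /S3; apply: (iffP idP) => [h l r t | h].
  by move/forallP: h => /(_ l)/forallP/(_ r)/forallP/(_ t)/implyP.
apply/forallP => l; apply/forallP => r; apply/forallP => t.
exact/implyP/h.
Qed.

(** The local form of [S2 (move_entry F x c d)]: the source cell [c] disappears and only the
    neighbours of [d] matter. Apart from the freeness of the entry, (S.4) then compares entries of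
    distinct boxes only. *)
Definition fits F x d :=
  [forall r, adjacent d r ==> [forall y in F r, (y <= x)%N]] &&
  [forall l, adjacent l d ==> [forall y in F l, (x <= y)%N]].

Lemma fitsP F x d :
  reflect ((forall r y, adjacent d r -> y \in F r -> (y <= x)%N) /\
           (forall l y, adjacent l d -> y \in F l -> (x <= y)%N))
          (fits F x d).
Proof.
apply: (iffP andP) => [[h1 h2]|[h1 h2]]; split.
- by move=> r y adj; move/forallP: h1 => /(_ r)/implyP/(_ adj)/forallP/(_ y)/implyP.
- by move=> r y adj; move/forallP: h2 => /(_ r)/implyP/(_ adj)/forallP/(_ y)/implyP.
- apply/forallP => r; apply/implyP => adj; apply/forallP => y.
  by apply/implyP => yr; apply: h1 adj yr.
- apply/forallP => r; apply/implyP => adj; apply/forallP => y.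
  by apply/implyP => yr; apply: h2 adj yr.
Qed.

Lemma adjacent_col l r : adjacent l r -> col r = (col l).+1.
Proof. by case/andP=> _ /eqP. Qed.

(** Taking [x] out of [c] cannot violate (S.2), and [c], lying in the column of [d], is no neighbour
    of [d]. The only new comparisons are those of [x] with the neighbours of [d]. *)
Lemma S2_move F x c d : S2 F -> x \in F c -> col d = col c -> d != c ->
  S2 (move_entry F x c d) = fits F x d.
Proof.
move=> /S2P F2 xc edc ndc; apply/S2P/fitsP => [h | [h1 h2] l r u v adj].
  have xd : x \in move_entry F x c d d by rewrite ffunE eqxx in_setU1 eqxx.
  have other e y : col e <> col d -> y \in F e -> y \in move_entry F x c d e.
    move=> ne ye; rewrite ffunE; case: eqP => [eed|_]; first by case: ne;
      rewrite eed.
    by case: eqP => // eec; case: ne; rewrite eec edc.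
  split=> e y adj ye.
    by apply: (h _ _ _ _ adj xd); apply: other ye; rewrite (adjacent_col adj); lia.
  apply: (h _ _ _ _ adj _ xd); apply: other ye.
  by move: (adjacent_col adj); lia.
have sub e y : e != d -> y \in move_entry F x c d e -> y \in F e.
  move=> ne; rewrite ffunE (negbTE ne); case: eqP => // ->.
  by rewrite in_setD1 => /andP[].
have subd y : y \in move_entry F x c d d -> y = x \/ y \in F d.
  by rewrite ffunE eqxx in_setU1 => /orP[/eqP|]; [left|right].
have [eld|nld] := eqVneq l d; have [erd|nrd] := eqVneq r d.
- by move: (adjacent_col adj); rewrite eld erd; lia.
- move: adj; rewrite eld => adj /subd[-> | ud] /(sub _ _ nrd) vr;
    first exact: h1 adj vr.
  exact: F2 adj ud vr.
- move: adj; rewrite erd => adj /(sub _ _ nld) ul /subd[-> | vd];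
    first exact: h2 adj ul.
  exact: F2 adj ul vd.
- move=> /(sub _ _ nld) ul /(sub _ _ nrd) vr; exact: F2 adj ul vr.
Qed.

Lemma S4P F : S2 F ->
  reflect (forall c d x, x \in F c -> (x : nat) != anchor F c ->
             col d = col c -> d != c -> (x < anchor F d)%N -> fits F x d ->
             (anchor F c <= anchor F d)%N) (S4 F).
Proof.
move=> F2; rewrite /S4; apply: (iffP idP) => [h c d x xc xa edc ndc xd fit | h].
  move/forallP: h => /(_ c)/forallP/(_ x)/implyP.
  rewrite /free_entry xc xa => /(_ isT)/forallP/(_ d)/implyP; apply.
  by rewrite edc eqxx xd S2_move.
apply/forallP => c; apply/forallP => x; apply/implyP => /andP[xc xa].
apply/forallP => d; apply/implyP => /and3P[/eqP edc xd].
have [->//|ndc] := eqVneq d c.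
by rewrite S2_move // => fit; apply: h fit.
Qed.

Lemma S5'P F :
  reflect ((forall c, col c = 0%N -> (anchor F c <= row c)%N) /\
           (forall c d, col c = 0%N -> col d = 0%N -> (row c < row d)%N ->
              (anchor F c < anchor F d)%N)) (S5' F).
Proof.
apply: (iffP andP) => [[h1 h2]|[h1 h2]]; split.
- by move=> c /eqP c0; move/forallP: h1 => /(_ c)/implyP; apply.
- move=> c d /eqP c0 /eqP d0 cd;
    move/forallP: h2 => /(_ c)/forallP/(_ d)/implyP; apply.
  by rewrite c0 d0 cd.
- by apply/forallP => c; apply/implyP => /eqP; apply: h1.
- apply/forallP => c; apply/forallP => d; apply/implyP.
  by case/and3P=> /eqP c0 /eqP d0; apply: h2.
Qed.

Lemma cell_eq c d : row c = row d -> col c = col d -> c = d.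
Proof.
case: c d => [i j] [i' j']; rewrite /row /col /= => eii'; subst i' => /= ejj'.
by congr (Tagged _ _); apply: val_inj.
Qed.

Lemma row_start c : exists2 d : cell a, row d = row c & col d = 0%N.
Proof.
case: c => i j; have h : (0 < a i)%N by case: j => m /= /(leq_trans _); apply.
by exists (Tagged (fun i => 'I_(a i)) (Ordinal h)).
Qed.

(** Chains (S.2) through the boxes in between, which are nonempty, by induction on the column of
    [d]. *)
Lemma row_decreasing F : is_filling F -> S2 F ->
  forall c d x y, row c = row d -> (col c < col d)%N ->
    x \in F c -> y \in F d -> (y <= x)%N.
Proof.
move=> F0 /S2P F2 c [i j] x y; rewrite /row /col /= => erow.
case: j => m hm /=; elim: m hm y => // m IH hm y.
have hm' : (m < a i)%N by apply: ltnW.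
set d' : cell a := Tagged (fun i => 'I_(a i)) (Ordinal hm').
set d : cell a := Tagged (fun i => 'I_(a i)) (Ordinal hm).
have adj : adjacent d' d by rewrite /adjacent /row /col /= !eqxx.
have [z zd'] := is_fillingP _ F0 d'.
move=> cm xc yd; have zy := F2 _ _ _ _ adj zd' yd.
move: cm; rewrite ltnS leq_eqVlt => /orP[/eqP ec|cm].
  apply: (F2 _ _ _ _ adj _ yd); suff <- : c = d' by [].
  exact: cell_eq.
exact: leq_trans zy (IH hm' z cm xc zd').
Qed.

End Fillings.

(** * Coarsenings preserve and reflect (S.1)-(S.4) *)

Section Coarsening.

Variables (n : nat) (a : 'X_{1..n}).
Implicit Types (F S T : filling a) (c d l r t : cell a) (x y k : 'I_n).
Implicit Types (f g : {ffun 'I_n -> 'I_n}).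

(** Values of [f] at integers that do not occur in [T] are unconstrained, so uniqueness of [f] can
    only be claimed on the entries of [T]. *)
Definition coarsening T f :=
  [forall c, forall d, forall x in T c, forall y in T d, (x < y)%N ==>
     (f x < f y)%N || (f x == f y) && ((c == d) || (col d < col c)%N)].

Definition push T f : filling a := [ffun c => f @: T c].

Lemma coarseningP T f :
  reflect (forall c d x y, x \in T c -> y \in T d -> (x < y)%N ->
             (f x < f y)%N || (f x == f y) && ((c == d) || (col d < col c)%N))
          (coarsening T f).
Proof.
rewrite /coarsening; apply: (iffP idP) => [h c d x y xc yd xy | h].
  move/forallP: h => /(_ c)/forallP/(_ d)/forallP/(_ x)/implyP/(_ xc).
  by move=> /forallP/(_ y)/implyP/(_ yd)/implyP/(_ xy).
apply/forallP => c; apply/forallP => d; apply/forallP => x; apply/implyP => xc.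
apply/forallP => y; apply/implyP => yd; apply/implyP; exact: h.
Qed.

Lemma coarsening_le T f c d x y : coarsening T f -> x \in T c -> y \in T d ->
  (x <= y)%N -> (f x <= f y)%N.
Proof.
move=> /coarseningP Tf xc yd; rewrite leq_eqVlt => /orP[/eqP/val_inj->//|xy].
by have /orP[/ltnW//|/andP[/eqP-> _]] := Tf c d x y xc yd xy.
Qed.

(** A merge needs the larger entry in the same box or strictly further left, which the hypotheses on
    [c] and [d] exclude. The comparisons between different boxes in (S.1)-(S.4) can all be put in
    this form. *)
Lemma coarsening_lt T f c d x y : coarsening T f -> x \in T c -> y \in T d ->
  c != d -> (col c <= col d)%N -> (f x < f y)%N = (x < y)%N.
Proof.
move=> Tf xc yd ncd cd; case: (ltnP x y) => [xy|yx].
  have /orP[//|] := coarseningP _ _ Tf c d x y xc yd xy.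
  by rewrite (negbTE ncd) ltnNge cd andbF.
by apply/negbTE; rewrite -leqNgt (coarsening_le Tf yd xc).
Qed.

Lemma mem_push T f c x : x \in T c -> f x \in push T f c.
Proof. by move=> xc; rewrite ffunE imset_f. Qed.

Lemma push_inv T f c y : y \in push T f c -> exists2 x, x \in T c & y = f x.
Proof. by rewrite ffunE => /imsetP. Qed.

Lemma is_filling_push T f : is_filling (push T f) = is_filling T.
Proof.
apply/is_fillingP/is_fillingP => h c; have [x xc] := h c.
  by have [y yc _] := push_inv xc; exists y.
by exists (f x); apply: mem_push.
Qed.

Lemma anchor_push T f c x : coarsening T f -> x \in T c -> anchor T c = x ->
  anchor (push T f) c = f x.
Proof.
move=> Tf xc ex; apply: anchor_eq; first exact: mem_push.
move=> x' /push_inv[y yc ->]; apply: (coarsening_le Tf yc xc).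
by rewrite -ex leq_anchor.
Qed.

Lemma S1_push T f : coarsening T f -> S1 (push T f) = S1 T.
Proof.
move=> Tf; apply/S1P/S1P => [h c d x ecd xc xd | h c d x' ecd /push_inv[x xc ->]].
  by apply: (h c d (f x)); rewrite ?mem_push.
move=> /push_inv[y yd efxy].
have [//|ncd] := eqVneq c d.
have [xy|yx|/val_inj exy] := ltngtP x y.
- by move: xy; rewrite -(coarsening_lt Tf xc yd) ?ecd // efxy ltnn.
- by move: yx; rewrite -(coarsening_lt Tf yd xc) ?ecd 1?eq_sym // efxy ltnn.
- by apply: (h c d x) => //; rewrite exy.
Qed.

Lemma adjacent_neq l r : adjacent l r -> l != r.
Proof. by move/adjacent_col=> e; apply/eqP=> elr; move: e; rewrite elr; lia. Qed.

Lemma S2_push T f : coarsening T f -> S2 (push T f) = S2 T.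
Proof.
move=> Tf; apply/S2P/S2P => [h l r x y adj xl yr | h l r x' y' adj].
  rewrite leqNgt -(coarsening_lt Tf xl yr) ?adjacent_neq //; last first.
    by rewrite (adjacent_col adj).
  by rewrite -leqNgt; apply: (h l r); rewrite ?mem_push.
move=> /push_inv[x xl ->] /push_inv[y yr ->].
rewrite leqNgt (coarsening_lt Tf xl yr) ?adjacent_neq //; last first.
  by rewrite (adjacent_col adj).
by rewrite -leqNgt; apply: (h l r).
Qed.

Lemma col_neq c d : col c != col d -> c != d.
Proof. by apply: contraNneq => ->. Qed.

Lemma row_neq c d : row c != row d -> c != d.
Proof. by apply: contraNneq => ->. Qed.

Lemma S3_push T f : is_filling T -> coarsening T f -> S3 (push T f) = S3 T.
Proof.
move=> T0 Tf.
suff e l r t : typeA l r t || typeB l r t ->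
    inversion (anchor (push T f) l) (anchor (push T f) r) (anchor (push T f) t)
    = inversion (anchor T l) (anchor T r) (anchor T t).
  by apply/S3P/S3P => h l r t lrt; [rewrite -e | rewrite e] => //; apply: h.
have [x xl ex] := anchor_mem l T0.
have [y yr ey] := anchor_mem r T0.
have [z zt ez] := anchor_mem t T0.
rewrite (anchor_push Tf xl) // (anchor_push Tf yr) // (anchor_push Tf zt) //.
rewrite ex ey ez => h.
(* In both types the third box shares its column with [r] or with [l] and differs from that box, so
   each of the three comparisons in [inversion] falls under [coarsening_lt]. *)
have [adj cs] : adjacent l r /\
    (col t = col r /\ t != r \/ col t = col l /\ l != t).
  case/orP: h => /and4P[adj rt /eqP ct _]; split=> //; [left|right]; split=> //.
    by apply: row_neq; move: rt; rewrite neq_ltn => ->; rewrite orbT.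
  by apply: row_neq; move: rt; rewrite neq_ltn => ->; rewrite orbT.
have clr := adjacent_col adj.
rewrite /inversion.
have -> : (f z < f y)%N = (z < y)%N.
  apply: (coarsening_lt Tf zt yr); last by case: cs => [[-> _]|[-> _]]; lia.
  by case: cs => [[_ ->]//|[h1 _]]; apply: col_neq; lia.
have -> : (f y <= f x)%N = (y <= x)%N.
  rewrite leqNgt (coarsening_lt Tf xl yr) ?adjacent_neq ?clr //.
  by rewrite -leqNgt.
have -> // : (f x < f z)%N = (x < z)%N.
apply: (coarsening_lt Tf xl zt); last by case: cs => [[-> _]|[-> _]]; lia.
by case: cs => [[h1 _]|[_ ->]//]; apply: col_neq; lia.
Qed.

Lemma fits_push T f c d x : coarsening T f -> x \in T c -> col d = col c ->
  fits (push T f) (f x) d = fits T x d.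
Proof.
move=> Tf xc edc; apply/fitsP/fitsP => -[h1 h2]; split.
- move=> r y adj yr; have := adjacent_col adj => cr.
  rewrite leqNgt -(coarsening_lt Tf xc yr) ?col_neq -?leqNgt; try lia.
  by apply: (h1 r); rewrite ?mem_push.
- move=> r y adj yr; have := adjacent_col adj => cr.
  rewrite leqNgt -(coarsening_lt Tf yr xc) ?col_neq -?leqNgt; try lia.
  by apply: (h2 r); rewrite ?mem_push.
- move=> r x' adj /push_inv[y yr ->]; have := adjacent_col adj => cr.
  rewrite leqNgt (coarsening_lt Tf xc yr) ?col_neq -?leqNgt; try lia.
  exact: (h1 r).
- move=> r x' adj /push_inv[y yr ->]; have := adjacent_col adj => cr.
  rewrite leqNgt (coarsening_lt Tf yr xc) ?col_neq -?leqNgt; try lia.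
  exact: (h2 r).
Qed.

Lemma S4_push T f : is_filling T -> S2 T -> coarsening T f ->
  S4 (push T f) = S4 T.
Proof.
move=> T0 T2 Tf; have S2S : S2 (push T f) by rewrite S2_push.
apply/(S4P S2S)/(S4P T2) => h c d.
  move=> x xc nx edc ndc.
  have [u uc eu] := anchor_mem c T0.
  have [v vd ev] := anchor_mem d T0.
  rewrite eu ev => xv fit; rewrite leqNgt -(coarsening_lt Tf vd uc) ?edc //.
  rewrite -leqNgt; have := h c d (f x) (mem_push f xc).
  rewrite (anchor_push Tf uc eu) (anchor_push Tf vd ev) edc ndc.
  rewrite (coarsening_lt Tf xc vd) ?edc 1?eq_sym // (fits_push Tf xc) // xv fit.
  (* If [f] merges [x] with the anchor [u] of [c], the image of [x] is not free and (S.4) says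
     nothing about it; but then [f u = f x < f v] directly. *)
  have [efx|_] := eqVneq (f x : nat) (f u); last by apply.
  move=> _; rewrite -efx ltnW // (coarsening_lt Tf xc vd) ?edc //.
  by rewrite eq_sym.
move=> x' /push_inv[x xc ->] nx edc ndc.
have [u uc eu] := anchor_mem c T0.
have [v vd ev] := anchor_mem d T0.
move: nx; rewrite (anchor_push Tf uc eu) (anchor_push Tf vd ev) => nx.
rewrite (coarsening_lt Tf xc vd) ?edc 1?eq_sym // (fits_push Tf xc) //.
move=> xv fit; rewrite leqNgt (coarsening_lt Tf vd uc) ?edc // -leqNgt.
rewrite -eu -ev; apply: (h c d x) => //; last by rewrite ev.
by rewrite eu; apply: contraNneq nx => /val_inj ->.
Qed.

Lemma QSSFE F : (F \in QSSF a) =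
  [&& is_filling F, S1 F, S2 F, S3 F, S4 F & S5' F].
Proof. by rewrite inE. Qed.

Lemma S5'_push_incr T f c d : is_filling T -> coarsening T f ->
  col c = 0%N -> col d = 0%N -> (row c < row d)%N ->
  (anchor (push T f) c < anchor (push T f) d)%N = (anchor T c < anchor T d)%N.
Proof.
move=> T0 Tf c0 d0 cd.
have [u uc eu] := anchor_mem c T0.
have [v vd ev] := anchor_mem d T0.
rewrite (anchor_push Tf uc eu) (anchor_push Tf vd ev) eu ev.
apply: (coarsening_lt Tf uc vd); last by rewrite c0 d0.
by apply: row_neq; rewrite neq_ltn cd.
Qed.

Lemma QSSF_push T f : T \in QSSF a -> coarsening T f ->
  (forall c, col c = 0%N -> (anchor (push T f) c <= row c)%N) ->
  push T f \in QSSF a.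
Proof.
rewrite !QSSFE => /and5P[T0 T1 T2 T3 /andP[T4 /S5'P[_ T5]]] Tf h.
rewrite is_filling_push S1_push // S2_push // S3_push // S4_push // T0 T1 T2 T3.
rewrite T4 /=; apply/S5'P; split=> // c d c0 d0 cd.
by rewrite S5'_push_incr //; apply: T5.
Qed.

(** The order of the first-column anchors is reflected by any coarsening; the bound by the row
    descends to [T] because [f] lowers no entry. *)
Lemma QSSF_pull T f : push T f \in QSSF a -> coarsening T f ->
  (forall c x, x \in T c -> (x <= f x)%N) -> T \in QSSF a.
Proof.
rewrite !QSSFE is_filling_push => /and5P[T0 + + + /andP[+ /S5'P[T5 T5']]] Tf h.
rewrite S1_push // S2_push // => T1 T2.
rewrite S3_push // S4_push // => T3 T4.
rewrite T0 T1 T2 T3 T4 /=; apply/S5'P; split=> [c c0|c d c0 d0 cd]; last first.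
  by rewrite -(S5'_push_incr T0 Tf) //; apply: T5'.
have [u uc eu] := anchor_mem c T0.
by rewrite eu (leq_trans (h c u uc)) // -(anchor_push Tf uc eu) T5.
Qed.

End Coarsening.

(** * Existence and uniqueness of the quasiYamanouchi coarsening *)

Section Maximal.

Variables (n : nat) (a : 'X_{1..n}).
Implicit Types (F S T : filling a) (c d : cell a) (x y k : 'I_n).
Implicit Types (f g : {ffun 'I_n -> 'I_n}).

(* A value e witnessing the failure can be merged into, or renamed to, e + 1. *)
Lemma coarsening_bump T f : T \in QSSF a -> coarsening T f ->
  push T f \in QSSF a -> ~~ quasiYamanouchi (push T f) ->
  exists g, [/\ coarsening T g, push T g \in QSSF a,
                (forall x, (f x <= g x)%N) & exists x, (f x < g x)%N].
Proof.
move=> TQ Tf SQ; set S := push T f in SQ *.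
rewrite /quasiYamanouchi negb_forall => /existsP[e].
rewrite negb_forall => /existsP[c]; rewrite negb_imply negb_or.
case/and3P=> /andP[ec /forallP lm] alt1 alt2.
have {}lm d : e \in S d -> (col c <= col d)%N by apply/implyP/lm.
have {}alt2 d (j : 'I_n) : j = e.+1 :> nat -> j \in S d -> (col c <= col d)%N
  -> d = c.
  move=> ej jd cd; apply/eqP; apply: contraNT alt2 => ndc.
  by apply/existsP; exists d; apply/existsP; exists j; rewrite ej eqxx jd cd ndc.
have := SQ; rewrite QSSFE => /and5P[S0 /S1P S1' S2' _ /andP[_ /S5'P[S5 _]]].
(* If [e] were the last value, the first box of the row of [c] would have anchor [e], hence be [c]
   itself, and (S.5') would put it in row [e]: the first alternative of [quasiYamanouchi] would
   hold. *)
have e1n : (e.+1 < n)%N.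
  rewrite ltnNge; apply/negP => ne; move/negP: alt1; apply.
  have [d rd d0] := row_start c.
  have [u ud eu] := anchor_mem d S0.
  have lastn x : (x <= e)%N by have := ltn_ord x; lia.
  have eeu : (e <= u)%N.
    have [c0|] := posnP (col c);
      first by rewrite -eu leq_anchor // (cell_eq rd) // d0 c0.
    by rewrite -d0 => cd; apply: (row_decreasing S0 S2' rd cd).
  have {eeu}eue : u = e by apply: val_inj; have := lastn u; move: eeu; case: ltngtP.
  subst u; have c0 : col c = 0%N by apply/eqP; rewrite -leqn0 -d0 lm.
  have ecd : c = d by apply: (S1' _ _ e); rewrite ?c0 ?d0.
  have := S5 c c0; rewrite c0 ecd eu !eqxx /= andbT => er.
  by apply/eqP/val_inj/eqP; rewrite eqn_leq lastn.
pose e1 := Ordinal e1n.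
pose g : {ffun 'I_n -> 'I_n} := [ffun x => if f x == e then e1 else f x].
have gE x : g x = if f x == e then e1 else f x by rewrite ffunE.
have Tg : coarsening T g.
  apply/coarseningP => c1 d1 x y xc yd xy.
  have Tfxy := coarseningP _ _ Tf c1 d1 x y xc yd xy.
  rewrite !gE; case: eqP => [fx|nfx]; case: eqP => [fy|nfy].
  - by move: Tfxy; rewrite fx fy ltnn eqxx /= => ->; rewrite eqxx orbT.
  (* The new merge of [e] with [e + 1]. An [e + 1] weakly right of [c] lies in [c], and [c] is the
     leftmost box of [e]; so every [e + 1] is in [c] or strictly left of it, and every [e] is in [c]
     or strictly right of it. *)
  - move: Tfxy; rewrite fx /=; case: eqVneq => [efy|_]; first by case: nfy.
    rewrite orbF => ey; have [efy|ne] := eqVneq (f y : nat) e.+1; last first.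
      by have -> : (e1 < f y)%N by rewrite ltn_neqAle eq_sym ne.
    have e1d : f y \in S d1 by apply: mem_push.
    have -> : (e1 == f y) by apply/eqP/val_inj.
    rewrite /= -efy ltnn /=.
    have exc : e \in S c1 by rewrite -fx mem_push.
    have := lm c1 exc.
    have [cd|dc] := leqP (col c) (col d1).
      rewrite (alt2 d1 (f y)) // leq_eqVlt => /orP[/eqP h|->]; last by rewrite orbT.
      by rewrite (S1' c c1 e h ec exc) eqxx.
    by rewrite orbC; move=> h; rewrite (leq_trans dc).
  - move: Tfxy; rewrite fy; case: eqP => [h|_]; first by rewrite h in nfx.
    by rewrite orbF /= => h; rewrite ltnS ltnW.
  - exact: Tfxy.
have fg x : (f x <= g x)%N by rewrite gE; case: eqP => //= ->.
exists g; split=> //; last first.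
  by have [x xc ex] := push_inv ec; exists x; rewrite gE -ex eqxx /=.
(* A first-column anchor equal to [e] sits in [c]. Its row is not [e], since the first alternative
   of [quasiYamanouchi] fails, so the row exceeds [e] and the bound survives the increase. *)
apply: QSSF_push => // d d0.
have T0 : is_filling T by have := S0; rewrite is_filling_push.
have [u ud eu] := anchor_mem d T0.
have := S5 d d0; rewrite (anchor_push Tf ud eu) (anchor_push Tg ud eu) gE.
case: eqP => // fu /= ler; have ed : e \in S d by rewrite -fu mem_push.
have c0 : col c = 0%N by apply/eqP; rewrite -leqn0 -d0 lm.
have ecd : c = d by apply: (S1' _ _ e); rewrite ?c0 ?d0.
rewrite ltn_neqAle; move: ler; rewrite fu => ->; rewrite andbT.
move: alt1; rewrite c0 ecd /= (anchor_push Tf ud eu) fu eqxx andbT.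
by apply: contraNneq => h; apply/eqP/val_inj.
Qed.

Lemma coarsening_id T : coarsening T [ffun x => x].
Proof. by apply/coarseningP => c d x y _ _ xy; rewrite !ffunE xy. Qed.

Lemma push_id T : push T [ffun x => x] = T.
Proof.
apply/ffunP => c; rewrite ffunE; apply/setP => x.
apply/imsetP/idP => [[y yc ->]|xc]; first by rewrite ffunE.
by exists x; rewrite ?ffunE.
Qed.

Lemma exists_coarsening T : T \in QSSF a ->
  exists f, [/\ coarsening T f, push T f \in Q2F a & forall x, (x <= f x)%N].
Proof.
move=> TQ.
(* [m] bounds the sum of the [n - f x], which drops strictly at every bump. *)
suff H m f : coarsening T f -> push T f \in QSSF a ->
    (forall x, (x <= f x)%N) -> (\sum_x (n - f x) <= m)%N ->
    exists g, [/\ coarsening T g, push T g \in Q2F a & forall x, (x <= g x)%N].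
  apply: (H _ [ffun x => x]) (leqnn _); first exact: coarsening_id.
    by rewrite push_id.
  by move=> x; rewrite ffunE.
elim: m f => [|m IH] f Tf SQ xf hm.
all: have [qY|nqY] := boolP (quasiYamanouchi (push T f)).
1,3: by exists f; split=> //; rewrite inE SQ.
all: have [g [Tg gQ fg [x0 lx0]]] := coarsening_bump TQ Tf SQ nqY.
all: have lt : (\sum_x (n - g x) < \sum_x (n - f x))%N.
1,3: rewrite (bigD1 x0) //= [X in (_ < X)%N](bigD1 x0) //= -addSn leq_add //.
1,3: by have := ltn_ord (g x0); lia.
1,2: by apply: leq_sum => x _; apply: leq_sub2l.
  by move: (leq_trans lt hm); rewrite ltn0.
apply: (IH g Tg gQ); last by rewrite -ltnS (leq_trans lt).
by move=> x; apply: leq_trans (fg x).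
Qed.

(** Suppose [g x > f x] while [f] and [g] agree on larger entries. Then [f] sends all larger entries
    above [f x], so the leftmost [x] gives the leftmost [f x]. If it is an anchor in row [f x] of
    the first column, [g] breaks (S.5'). Otherwise some [y > x] with [g y = f y = f x + 1 <= g x]
    lies weakly right in another box, and [g] cannot be a coarsening. *)
Lemma coarsening_unique_lt T f g : T \in QSSF a ->
  coarsening T f -> push T f \in Q2F a ->
  coarsening T g -> push T g \in QSSF a ->
  forall c x, x \in T c ->
  (forall d y, y \in T d -> (x < y)%N -> f y = g y) -> (g x <= f x)%N.
Proof.
move=> TQ Tf + Tg gQ c0 x xc0 eqs; rewrite inE => /andP[fQ fY].
rewrite leqNgt; apply/negP => fgx.
have := TQ; rewrite QSSFE => /and5P[T0 /S1P T1 _ _ _].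
have := fQ; rewrite QSSFE => /and5P[F0 /S1P F1 _ _ _].
have := gQ; rewrite QSSFE => /and5P[_ _ _ _ /andP[_ /S5'P[G5 _]]].
have fup d y : y \in T d -> (x < y)%N -> (f x < f y)%N.
  move=> yd xy; rewrite (leq_trans fgx) // (eqs d) //.
  by apply: (coarsening_le Tg xc0 yd); apply: ltnW.
have [c xc lm] : exists2 c, x \in T c & forall d, x \in T d -> (col c <= col d)%N.
  by case: (@arg_minnP _ c0 (fun c => x \in T c) (fun c => col c) xc0) => c;
    exists c.
have lmS : leftmost (push T f) (f x) c.
  rewrite /leftmost mem_push //=; apply/forallP => d; apply/implyP.
  case/push_inv=> y yd efxy; have [xy|yx|/val_inj exy] := ltngtP x y.
  - by have := fup d y yd xy; rewrite efxy ltnn.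
  - have := coarseningP _ _ Tf d c y x yd xc yx; rewrite efxy ltnn eqxx /=.
    by case/orP=> [/eqP->//|/ltnW].
  - by apply: lm; rewrite exy.
move/forallP: fY => /(_ (f x))/forallP/(_ c)/implyP/(_ lmS).
case/orP=> [/and3P[/eqP c00 /eqP rc /eqP ac]|].
  have [u uc eu] := anchor_mem c T0.
  have eux : u = x.
    apply/ord_inj/eqP; rewrite eqn_leq -{2}eu leq_anchor // andbT.
    rewrite leqNgt; apply/negP => /(fup c _ uc).
    by rewrite -ac (anchor_push Tf uc eu) ltnn.
  have := G5 c c00; rewrite (anchor_push Tg uc eu) eux rc => h.
  by have := leq_ltn_trans h fgx; rewrite ltnn.
case/existsP=> d /existsP[j] /and4P[/eqP ej jd cd ndc].
have [y yd ejy] := push_inv jd.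
have xy : (x < y)%N.
  rewrite ltnNge; apply/negP => /(coarsening_le Tf yd xc).
  by rewrite -ejy ej ltnn.
have := coarseningP _ _ Tg c d x y xc yd xy.
rewrite -(eqs d y yd xy) -ejy ej ltnS leqNgt fgx /=.
rewrite (negbTE (_ : c != d)) /=; last by rewrite eq_sym.
by rewrite ltnNge cd andbF.
Qed.

Lemma coarsening_unique T f g : T \in QSSF a ->
  coarsening T f -> push T f \in Q2F a ->
  coarsening T g -> push T g \in Q2F a ->
  forall c x, x \in T c -> f x = g x.
Proof.
move=> TQ Tf fQ Tg gQ c x.
(* Downward induction on [x], so that the larger entries are settled first. *)
have [m] := ubnP (n - x); elim: m c x => // m IH c x hm xc.
have eqs d y : y \in T d -> (x < y)%N -> f y = g y.
  by move=> yd xy; apply: (IH d) => //; have := ltn_ord y; move: hm; lia.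
have fQ' : push T f \in QSSF a by move: fQ; rewrite inE => /andP[].
have gQ' : push T g \in QSSF a by move: gQ; rewrite inE => /andP[].
apply/val_inj/eqP; rewrite eqn_leq; apply/andP; split.
  apply: (coarsening_unique_lt TQ Tg gQ Tf fQ' xc) => d y yd xy.
  by rewrite (eqs d y).
exact: (coarsening_unique_lt TQ Tf fQ Tg gQ' xc).
Qed.

End Maximal.

(** Pigeonhole: it turns bounds on positions into a description of all boxes holding a given
    value. *)
Lemma interval_onto (X : finType) (A : {set X}) (h : X -> nat) lo len :
  {in A &, injective h} -> (forall x, x \in A -> (lo <= h x < lo + len)%N) ->
  #|A| = len ->
  forall g, (lo <= g < lo + len)%N -> exists2 x, x \in A & h x = g.
Proof.
move=> hinj hA cA g hg.
have u : uniq [seq h x | x <- enum A].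
  by rewrite map_inj_in_uniq ?enum_uniq // => x y; rewrite !mem_enum; apply: hinj.
have sub : {subset [seq h x | x <- enum A] <= iota lo len}.
  by move=> y /mapP[x]; rewrite mem_enum => xA ->; rewrite mem_iota hA.
have sz : (size (iota lo len) <= size [seq h x | x <- enum A])%N.
  by rewrite size_map size_iota -cardE cA.
have [_ e] := uniq_min_size u sub sz.
have : g \in iota lo len by rewrite mem_iota.
by rewrite -e => /mapP[x]; rewrite mem_enum => xA ->; exists x.
Qed.

Lemma card_pairs (I X : finType) (P : I -> X -> bool) (Q : pred I) :
  #|[set p : I * X | Q p.1 && P p.1 p.2]| =
  (\sum_(i | Q i) #|[set x | P i x]|)%N.
Proof.
transitivity (\sum_(i | Q i) \sum_(x | P i x) 1)%N.
  rewrite pair_big_dep /= sum1_card; apply: eq_card => p.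
  by rewrite inE.
by apply: eq_bigr => i _; rewrite sum1_card cardsE.
Qed.

(** * Reading-order positions and red values *)

Section Positions.

Variables (n : nat) (a : 'X_{1..n}).
Implicit Types (F S T : filling a) (c d : cell a) (x y k e : 'I_n).
Implicit Types (f g : {ffun 'I_n -> 'I_n}) (p q : 'I_n * cell a).
Implicit Types (b : 'X_{1..n}) (R : {set 'I_n}).

Lemma wtE F k : wt F k = #|[set c | k \in F c]|.
Proof. by rewrite mnmE. Qed.

(* The subtraction does not truncate when the entries of R are positive. *)
Definition psum b R m := (\sum_(i < n | (i < m)%N) (b i - (i \in R)))%N.

Lemma psum_mono b R m m' : (m <= m')%N -> (psum b R m <= psum b R m')%N.
Proof.
move=> mm'; rewrite /psum [X in (_ <= X)%N](bigID (fun i : 'I_n => (i < m)%N)) /=.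
rewrite [X in (_ <= X + _)%N](eq_bigl (fun i : 'I_n => (i < m)%N)) ?leq_addr //.
by move=> i /=; case: (ltnP i m); rewrite ?andbT ?andbF // => /leq_trans ->.
Qed.

Lemma psumS b R k : psum b R k.+1 = (psum b R k + (b k - (k \in R)))%N.
Proof.
rewrite /psum (bigD1 k) //= addnC; congr (_ + _)%N; apply: eq_bigl => i.
by rewrite ltnS andbC -(inj_eq val_inj) /= -ltn_neqAle.
Qed.

Lemma psum0 b R : psum b R 0 = 0%N.
Proof. by rewrite /psum big_pred0. Qed.

(* Entries of a filling, read by increasing value and, for equal values, from
   right to left. *)
Definition prec p q :=
  (p.1 < q.1)%N || (p.1 == q.1) && (col q.2 < col p.2)%N.

(** The rank of an entry in reading order, counted from 0. *)
Definition position S p := #|[set q | (q.1 \in S q.2) && prec q p]|.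

Lemma prec_trans : transitive prec.
Proof.
move=> q p r; rewrite /prec => /orP[pq|/andP[/eqP-> pq]].
  by case/orP=> [qr|/andP[/eqP<- _]]; rewrite ?pq // (ltn_trans pq qr).
case/orP=> [->//|/andP[/eqP-> qr]].
by rewrite eqxx (ltn_trans qr pq) orbT.
Qed.

Lemma position_lt S p q : p.1 \in S p.2 -> prec p q ->
  (position S p < position S q)%N.
Proof.
move=> pS pq; apply: proper_card; apply/properP; split.
  by apply/subsetP => r; rewrite !inE => /andP[-> /prec_trans]; apply.
exists p; rewrite !inE pS //.
by rewrite /prec !ltnn andbF.
Qed.

Lemma prec_total S p q : S1 S -> p.1 \in S p.2 -> q.1 \in S q.2 ->
  [\/ p = q, prec p q | prec q p].
Proof.
move=> /S1P S1'; case: p q => [x c] [y d] /= xc yd; rewrite /prec /=.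
have [xy|yx|/ord_inj exy] := ltngtP x y.
- by apply: Or32.
- by apply: Or33.
subst y; rewrite eqxx /=.
have [cd|dc|ecd] := ltngtP (col c) (col d).
- by apply: Or33.
- by apply: Or32.
by apply: Or31; rewrite (S1' c d x).
Qed.

Lemma position_inj S p q : S1 S -> p.1 \in S p.2 -> q.1 \in S q.2 ->
  position S p = position S q -> p = q.
Proof.
move=> S1' pS qS epq; have [//|h|h] := prec_total S1' pS qS.
  by have := position_lt pS h; rewrite epq ltnn.
by have := position_lt qS h; rewrite epq ltnn.
Qed.

(** The position at which the entries of value [m] begin in reading order. *)
Definition wsum S m := (\sum_(i < n | (i < m)%N) wt S i)%N.

Lemma wsumE S m :
  wsum S m = #|[set q : 'I_n * cell a | (q.1 < m)%N && (q.1 \in S q.2)]|.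
Proof.
rewrite (card_pairs (fun i c => i \in S c) (fun i => (i < m)%N));
  apply: eq_bigr => i _.
by rewrite wtE.
Qed.

Lemma wsumS S e : wsum S e.+1 = (wsum S e + wt S e)%N.
Proof.
rewrite /wsum (bigD1 e) //= addnC; congr (_ + _)%N; apply: eq_bigl => i.
by rewrite ltnS andbC -(inj_eq val_inj) /= -ltn_neqAle.
Qed.

Lemma wsum_mono S m m' : (m <= m')%N -> (wsum S m <= wsum S m')%N.
Proof.
move=> mm'; rewrite !wsumE; apply/subset_leq_card/subsetP => q.
by rewrite !inE => /andP[qm ->]; rewrite (leq_trans qm).
Qed.

Lemma position_bounds S e c : e \in S c ->
  (wsum S e <= position S (e, c) < wsum S e + wt S e)%N.
Proof.
move=> ec; rewrite -wsumS !wsumE; apply/andP; split.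
  apply/subset_leq_card/subsetP => q; rewrite !inE => /andP[qe ->].
  by rewrite /prec /= qe.
apply: proper_card; apply/properP; split.
  apply/subsetP => q; rewrite !inE => /andP[-> /orP[/ltnW|/andP[/eqP-> _]]] /=.
    by rewrite ltnS => ->.
  by rewrite ltnSn.
by exists (e, c); rewrite !inE /prec /= ?ltnSn ?ec // !ltnn andbF.
Qed.

Lemma position_onto S e m : S1 S ->
  (wsum S e <= m < wsum S e + wt S e)%N ->
  exists2 c, e \in S c & position S (e, c) = m.
Proof.
move=> S1' hm.
have [||||c] := @interval_onto _ [set c | e \in S c]
  (fun c => position S (e, c)) (wsum S e) (wt S e) _ _ _ m.
- move=> c d; rewrite !inE => ec ed epq.
  by have [] := @position_inj S (e, c) (e, d) S1' ec ed epq.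
- by move=> c; rewrite inE; apply: position_bounds.
- by rewrite wtE.
- exact: hm.
by rewrite inE => ec ecm; exists c.
Qed.

(** The occurrences lost under [push]: [k] falls together with a smaller value of its own box. *)
Definition redpair T f k c :=
  (k \in T c) && [exists x : 'I_n, [&& (x < k)%N, f x == f k & x \in T c]].

(** The occurrences kept under [push]: the least value of a class in a box represents the image
    entry. *)
Definition minrep T f k c := (k \in T c) && ~~ redpair T f k c.

Definition red T f := [set k | [exists c, redpair T f k c]].

Lemma redpairP T f k c :
  reflect (k \in T c /\ exists x, [/\ (x < k)%N, f x = f k & x \in T c])
          (redpair T f k c).
Proof.
apply: (iffP andP) => -[kc h]; split=> //.
  by case/existsP: h => x /and3P[xk /eqP fx xc]; exists x.
by case: h => x [xk fx xc]; apply/existsP; exists x; rewrite xk fx eqxx.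
Qed.

Lemma same_class T f c d x y : coarsening T f -> x \in T c -> y \in T d ->
  (x < y)%N -> f x = f y -> c = d \/ (col d < col c)%N.
Proof.
move=> /coarseningP Tf xc yd xy fxy.
have := Tf c d x y xc yd xy; rewrite fxy ltnn eqxx /=.
by case/orP=> [/eqP|]; [left|right].
Qed.

(** If [c] and [d] differ, the smaller value in [c] forces [d] strictly left of [c], and the one in
    [d] forces the opposite. Hence a red value loses exactly one occurrence. *)
Lemma redpair_unique T f k c d : coarsening T f ->
  redpair T f k c -> redpair T f k d -> c = d.
Proof.
move=> Tf /redpairP[kc [x [xk fx xc]]] /redpairP[kd [y [yk fy yd]]].
have [//|h1] := same_class Tf xc kd xk fx.
have [//|h2] := same_class Tf yd kc yk fy.
by have := ltn_trans h1 h2; rewrite ltnn.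
Qed.

Lemma card_redpair T f k : coarsening T f ->
  #|[set c | redpair T f k c]| = (k \in red T f).
Proof.
move=> Tf; rewrite inE; case: existsP => [[c kc]|h].
  rewrite (_ : [set _ | _] = [set c]) ?cards1 //; apply/setP => d.
  rewrite !inE; apply/idP/eqP => [kd|->//].
  exact: redpair_unique kd kc.
apply/eqP; rewrite cards_eq0; apply/eqP/setP => c; rewrite !inE.
by apply/negP => kc; apply: h; exists c.
Qed.

Lemma wt_minrep T f k : coarsening T f ->
  wt T k = (#|[set c | minrep T f k c]| + (k \in red T f))%N.
Proof.
move=> Tf; rewrite -card_redpair // wtE addnC.
rewrite -cardsUI [X in _ = (_ + X)%N](_ : _ = 0%N) ?addn0; last first.
  apply/eqP; rewrite cards_eq0; apply/eqP/setP => c; rewrite !inE /minrep.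
  by case: (redpair T f k c); rewrite ?andbF.
apply: eq_card => c; rewrite !inE /minrep.
by have [/redpairP[-> _]|_] := boolP (redpair T f k c); rewrite ?andbT.
Qed.

Lemma minrep_sub T f k c : minrep T f k c -> k \in T c.
Proof. by case/andP. Qed.

Lemma ex_minrep T f k c : k \in T c ->
  exists x, [/\ minrep T f x c, f x = f k & (x <= k)%N].
Proof.
move=> kc.
have Pk : (k \in T c) && (f k == f k) by rewrite kc eqxx.
case: (@arg_minnP _ k (fun x => (x \in T c) && (f x == f k)) (fun x => x : nat) Pk).
move=> x /andP[xc /eqP fx] xmin; exists x; split=> //; last by rewrite xmin.
rewrite /minrep xc; apply/negP => /redpairP[_ [y [yx fy yc]]].
by have := xmin y; rewrite yc fy fx eqxx leqNgt yx => /(_ isT).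
Qed.

Lemma minrep_inj T f x y c : minrep T f x c -> minrep T f y c ->
  f x = f y -> x = y.
Proof.
move=> /andP[xc nx] /andP[yc ny] fxy; have [xy|yx|/ord_inj//] := ltngtP x y.
  by case/redpairP: ny; split=> //; exists x.
by case/redpairP: nx; split=> //; exists y.
Qed.

(* Sending a pair to its class and cell is a bijection from the pairs [minrep]
   to the entries of [push T f]. *)
Lemma card_minrep T f (P : 'I_n -> cell a -> bool) :
  #|[set q | (q.1 \in push T f q.2) && P q.1 q.2]| =
  #|[set q | minrep T f q.1 q.2 && P (f q.1) q.2]|.
Proof.
rewrite -(@card_in_imset _ _ (fun q => (f q.1, q.2))
            [set q | minrep T f q.1 q.2 && P (f q.1) q.2]); last first.
  move=> [x c] [y d]; rewrite !inE /= => /andP[mx _] /andP[my _] [fxy ecd].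
  by subst d; rewrite (minrep_inj mx my).
apply: eq_card => -[e c]; rewrite inE /=; apply/andP/imsetP => [[ec Pe]|].
  have [k kc efk] := push_inv ec; have [x [mx fx _]] := ex_minrep f kc.
  by exists (x, c); rewrite ?inE /= ?fx -?efk // mx.
case=> -[x d]; rewrite inE /= => /andP[mx Px] [-> ->]; split=> //.
by rewrite mem_push ?(minrep_sub mx).
Qed.

Lemma wt_push T f e : coarsening T f ->
  wt (push T f) e = (\sum_(k | f k == e) (wt T k - (k \in red T f)))%N.
Proof.
move=> Tf; transitivity (\sum_(i | i == e) #|[set c | i \in push T f c]|)%N.
  by rewrite big_pred1_eq wtE.
rewrite -(card_pairs (fun i c => i \in push T f c) (fun i => i == e)).
rewrite (eq_card (B := [set q : 'I_n * cell a | (q.1 \in push T f q.2) &&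
  (q.1 == e)]));
  last by move=> q; rewrite !inE andbC.
rewrite (card_minrep T f (fun i _ => i == e)).
rewrite (eq_card (B := [set q : 'I_n * cell a | (f q.1 == e) && minrep T f
  q.1 q.2]));
  last by move=> q; rewrite !inE andbC.
rewrite (card_pairs (minrep T f) (fun k => f k == e)); apply: eq_bigr => k _.
by rewrite (wt_minrep _ Tf) addnK.
Qed.

Lemma psum_minrep T f m : coarsening T f ->
  psum (wt T) (red T f) m =
  #|[set q : 'I_n * cell a | (q.1 < m)%N && minrep T f q.1 q.2]|.
Proof.
move=> Tf; rewrite (card_pairs (minrep T f) (fun k => (k < m)%N));
  apply: eq_bigr => k _.
by rewrite (wt_minrep _ Tf) addnK.
Qed.

Lemma position_minrep T f k c :
  position (push T f) (f k, c) =
  #|[set q | minrep T f q.1 q.2 && prec (f q.1, q.2) (f k, c)]|.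
Proof. exact: (card_minrep T f (fun e d => prec (e, d) (f k, c))). Qed.

Lemma minrep_lt_prec T f k c x d : coarsening T f -> minrep T f k c ->
  minrep T f x d -> (x < k)%N -> prec (f x, d) (f k, c).
Proof.
move=> Tf mk mx xk; rewrite /prec /=.
have kc := minrep_sub mk; have xd := minrep_sub mx.
have := coarsening_le Tf xd kc (ltnW xk);
  rewrite leq_eqVlt => /orP[/eqP/ord_inj e|->//].
have [edc|->] := same_class Tf xd kc xk e; last by rewrite e eqxx orbT.
subst d; move: (minrep_inj mk mx (esym e)) => ekx.
by move: xk; rewrite ekx ltnn.
Qed.

Lemma prec_leq T f k c x d : coarsening T f -> k \in T c -> x \in T d ->
  prec (f x, d) (f k, c) -> (x <= k)%N.
Proof.
move=> Tf kc xd; rewrite /prec /= => h; rewrite leqNgt; apply/negP => kx.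
have := coarseningP _ _ Tf c d k x kc xd kx.
case/orP: h => [h|/andP[/eqP -> h]].
  rewrite ltnNge (ltnW h) /= => /andP[/eqP e _].
  by move: h; rewrite e ltnn.
rewrite ltnn eqxx /= => /orP[/eqP e|]; first by move: h; rewrite e ltnn.
by move=> h'; move: (ltn_trans h h'); rewrite ltnn.
Qed.

(** The [minrep] pairs ordered by value follow the reading order of [push T f]. So the entries [k]
    lie at positions from [psum k] up to, but excluding, [psum k.+1], extended by one position to
    the left when [k] is red: the position shared with a smaller value of its class. *)
Lemma position_entry T f k c : coarsening T f -> k \in T c ->
  (psum (wt T) (red T f) k <= position (push T f) (f k, c) + (k \in red T f)
   /\ position (push T f) (f k, c) < psum (wt T) (red T f) k.+1)%N.
Proof.
move=> Tf kc.
have up : (position (push T f) (f k, c) < psum (wt T) (red T f) k.+1)%N.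
  have [x [mx fx xk]] := ex_minrep f kc.
  rewrite -fx position_minrep psum_minrep //; apply: proper_card.
  apply/properP; split.
    apply/subsetP => -[y d]; rewrite !inE /= => /andP[my h].
    rewrite my andbT ltnS; apply: leq_trans xk.
    exact: (prec_leq Tf (minrep_sub mx) (minrep_sub my)).
  exists (x, c); rewrite !inE /= ?mx ?ltnS ?xk //.
  by rewrite /prec /= !ltnn andbF.
split=> //; have [kr|nkr] := boolP (redpair T f k c); last first.
  have mk : minrep T f k c by rewrite /minrep kc.
  rewrite (leq_trans _ (leq_addr _ _)) // position_minrep psum_minrep //.
  apply/subset_leq_card/subsetP => -[y d]; rewrite !inE /= => /andP[yk my].
  by rewrite my (minrep_lt_prec Tf).
have -> : (k \in red T f) by rewrite inE; apply/existsP; exists c.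
have [x [mx fx xk]] := ex_minrep f kc.
rewrite addn1 -fx position_minrep psum_minrep //.
(* All kept occurrences of values below [k] precede the entry, except possibly the representative
   [(x, c)] of its own box; adding that pair accounts for the extra 1. *)
have -> : #|[set q | minrep T f q.1 q.2 && prec (f q.1, q.2) (f x, c)]|.+1 =
  #|(x, c) |: [set q | minrep T f q.1 q.2 && prec (f q.1, q.2) (f x, c)]|.
  by rewrite cardsU1 inE /prec /= !ltnn !andbF.
apply/subset_leq_card/subsetP => -[y d]; rewrite !inE /= => /andP[yk my].
rewrite my /= orbC; have [//|] := boolP (prec _ _).
rewrite /prec /= negb_or fx => /andP[h1 h2].
have yd := minrep_sub my.
have efy : f y = f k.
  apply/ord_inj/eqP; rewrite eqn_leq leqNgt andbC leqNgt h1 /=.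
  by rewrite -leqNgt (coarsening_le Tf yd kc) // ltnW.
move: h2; rewrite efy eqxx /= -leqNgt => dc.
have [edc|] := same_class Tf yd kc yk efy; last by rewrite ltnNge dc.
subst d; rewrite (minrep_inj my mx) ?eqxx //.
by rewrite efy.
Qed.

Lemma red_sub T f k : k \in red T f -> (0 < wt T k)%N.
Proof.
rewrite inE => /existsP[c /redpairP[kc _]]; rewrite wtE.
by apply/card_gt0P; exists c; rewrite inE.
Qed.

Lemma wt_gt0 T k : (0 < wt T k)%N = [exists c, k \in T c].
Proof.
rewrite wtE; apply/card_gt0P/existsP => -[c]; rewrite ?inE => kc; exists c => //.
by rewrite inE.
Qed.

(** The boxes holding [k] have distinct positions in the interval of [position_entry], as many as
    its length, so they fill it. The interval depends on the weight and the red set only, and a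
    position in [S] determines its box. *)
Lemma pull_unique T T' f f' S : S1 S ->
  coarsening T f -> coarsening T' f' -> push T f = S -> push T' f' = S ->
  wt T = wt T' -> red T f = red T' f' -> T = T'.
Proof.
have H U U' g g' : S1 S -> coarsening U g -> coarsening U' g' -> push U g = S ->
    push U' g' = S -> wt U = wt U' -> red U g = red U' g' ->
    forall c k, k \in U c -> k \in U' c; last first.
  move=> S1S Tf Tf' eS eS' ew er; apply/ffunP => c; apply/setP => k.
  by apply/idP/idP; [apply: (H T T' f f')|apply: (H T' T f' f)].
move=> S1S Uf Uf' eS eS' ew er c k kc.
set R := red U' g'; set b := wt U'.
have Rb : ((k \in R) <= b k)%N.
  by case: (boolP (k \in R)) => // /red_sub.
have psk : (psum b R k.+1 + (k \in R) = psum b R k + b k)%N.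
  by rewrite psumS -addnA subnK.
have inI V h d : coarsening V h -> push V h = S -> wt V = b -> red V h = R ->
    k \in V d -> (psum b R k <= position S (h k, d) + (k \in R) < psum b R k
      + b k)%N.
  move=> Vh eS1 eb eR kd; have := position_entry Vh kd.
  by rewrite eS1 eb eR -psk ltn_add2r => -[-> ->].
have inS d : k \in U' d -> g' k \in S d by rewrite -eS'; apply: mem_push.
have [||||d] := @interval_onto _ [set d | k \in U' d]
  (fun d => position S (g' k, d) + (k \in R))%N (psum b R k) (b k) _ _ _
  (position S (g k, c) + (k \in R))%N.
- move=> d d'; rewrite !inE => kd kd' /addIn e.
  by case: (@position_inj S (g' k, d) (g' k, d') S1S (inS _ kd) (inS _ kd') e).
- by move=> d; rewrite inE; apply: inI.
- by rewrite /b wtE.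
- exact: (inI U g).
rewrite inE => kd /addIn e.
have gkc : g k \in S c by rewrite -eS mem_push.
by have [_ <-] := @position_inj S (g' k, d) (g k, c) S1S (inS _ kd) gkc e.
Qed.

End Positions.

(** * Glides as weakly increasing maps *)

Section Glides.

Variable n : nat.
Implicit Types (w b : 'X_{1..n}) (R : {set 'I_n}) (k e i j : 'I_n).
Implicit Types (f : {ffun 'I_n -> 'I_n}).

Lemma mem_nz w e : (e \in nz_positions w) = (0 < w e)%N.
Proof. by rewrite mem_filter mem_enum andbT lt0n. Qed.

Lemma nz_uniq w : uniq (nz_positions w).
Proof. by rewrite filter_uniq ?enum_uniq. Qed.

Lemma nz_sorted w : sorted (fun i j => (i < j)%N) (nz_positions w).
Proof.
apply: sorted_filter; first by move=> j i k; apply: ltn_trans.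
have := iota_ltn_sorted 0 n; rewrite -val_enum_ord sorted_map.
by apply: sub_sorted.
Qed.

Lemma nz_nth_lt w x0 s t : (s < t < size (nz_positions w))%N ->
  (nth x0 (nz_positions w) s < nth x0 (nz_positions w) t)%N.
Proof.
case/andP=> st tz.
have tr : transitive (fun i j => (i < j)%N) by move=> j i k; apply: ltn_trans.
by apply: (sorted_ltn_nth tr x0 (nz_sorted w)) => //; rewrite inE (ltn_trans st).
Qed.

Lemma nz_index_lt w e e' : e \in nz_positions w -> e' \in nz_positions w ->
  (index e (nz_positions w) < index e' (nz_positions w))%N = (e < e')%N.
Proof.
move=> ew ew'; set ps := nz_positions w in ew ew' *.
have H i j : i \in ps -> j \in ps -> (index i ps < index j ps)%N -> (i < j)%N.
  move=> ip jp ij; rewrite -(nth_index e ip) -(nth_index e jp).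
  by apply: nz_nth_lt; rewrite ij index_mem.
apply/idP/idP; first exact: H.
apply: contraLR; rewrite -!leqNgt leq_eqVlt => /orP[/eqP h|].
  by have -> : e' = e by rewrite -(nth_index e ew') h nth_index.
by move=> /(H _ _ ew' ew)/ltnW.
Qed.

(** A glide without cut points: [f] sends a nonzero position of [b] to the n_j of its block. The
    field [glide_map_ge] stands for i_j <= n_j, and [glide_map_black] says that a red position is
    never the first nonzero one of its block. *)
Record glide_map w b R f : Prop := GlideMap {
  glide_map_pos : forall k, k \in R -> (0 < b k)%N;
  glide_map_mono : forall k k', (0 < b k)%N -> (0 < b k')%N -> (k <= k')%N ->
    (f k <= f k')%N;
  glide_map_ge : forall k, (0 < b k)%N -> (k <= f k)%N;
  glide_map_sum : forall e, (\sum_(k | f k == e) (b k - (k \in R)) = w e)%N;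
  glide_map_black : forall k, k \in R ->
    exists2 k' : 'I_n, (k' < k)%N & (0 < b k')%N /\ f k' = f k }.

(** The least nonzero position of the class of [k] is black, so it contributes a positive amount to
    [w (f k)]. *)
Lemma glide_map_supp w b R f k : glide_map w b R f -> (0 < b k)%N ->
  (0 < w (f k))%N.
Proof.
case=> _ _ _ hsum hblack bk.
have Pk : (0 < b k)%N && (f k == f k) by rewrite bk eqxx.
case: (@arg_minnP _ k (fun x => (0 < b x)%N && (f x == f k)) (fun x => x : nat) Pk).
move=> x /andP[bx /eqP fx] xmin; rewrite -hsum (bigD1 x) ?fx //= addn_gt0.
have [xR|_] := boolP (x \in R); last by rewrite subn0 bx.
have [y yx [by0 fy]] := hblack x xR.
by have := xmin y; rewrite by0 fy fx eqxx leqNgt yx => /(_ isT).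
Qed.

Lemma sum_black_red b R (P : pred 'I_n) : (forall k, k \in R -> (0 < b k)%N) ->
  (\sum_(k | P k) b k = \sum_(k | P k) (b k - (k \in R)) + #|[set k in R | P k]|)%N.
Proof.
move=> hR; have -> : #|[set k in R | P k]| = (\sum_(k | P k) (k \in R))%N.
  rewrite -sum1_card big_mkcond [RHS]big_mkcond; apply: eq_bigr => k _.
  by rewrite inE; case: (k \in R); case: (P k).
rewrite -big_split; apply: eq_bigr => k _ /=; rewrite subnK //.
by have [/hR|] := boolP (k \in R).
Qed.

Lemma glide_map_is_glide w b R f : glide_map w b R f -> is_glide w b R.
Proof.
move=> gm; have [hpos hmono hge hsum hblack] := gm.
set ps := nz_positions w.
have fps k : (0 < b k)%N -> f k \in ps by rewrite mem_nz; apply: glide_map_supp gm.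
pose idx k := index (f k) ps.
(* Each block ends just after its last nonzero position; zeros between two blocks go to the later
   one. *)
pose cut m := (\max_(k | (0 < b k)%N && (idx k < m)%N) k.+1)%N.
have cut_le m B : (forall k, (0 < b k)%N -> (idx k < m)%N -> (k < B)%N) ->
    (cut m <= B)%N.
  by move=> h; apply/bigmax_leqP => k /andP[bk /(h k bk)].
have lt_cut k m : (0 < b k)%N -> (k < cut m)%N = (idx k < m)%N.
  move=> bk; apply/idP/idP => [|km]; last first.
    by rewrite /cut (bigD1 k) ?bk //= leq_maxl.
  apply: contraTltn => mk; rewrite -leqNgt.
  apply: cut_le => k' bk' km; rewrite ltnNge; apply/negP => kk'.
  have : (idx k' < idx k)%N by apply: leq_trans km mk.
  by rewrite nz_index_lt ?fps // ltnNge hmono.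
have cut_ub m : (cut m < n.+1)%N by rewrite ltnS; apply: cut_le => k _ _.
apply/andP; split; first by apply/forallP => k; apply/implyP/hpos.
apply/existsP; exists [tuple (inord (cut i) : 'I_n.+1) | i < (size ps).+1].
have nthE m : (m <= size ps)%N -> nth ord0
    [tuple (inord (cut i) : 'I_n.+1) | i < (size ps).+1] m = cut m :> nat.
  rewrite -ltnS => mz; set s := [tuple _ | _ < _].
  have -> : nth ord0 s m = tnth s (Ordinal mz) by rewrite (tnth_nth ord0).
  by rewrite tnth_mktuple inordK.
apply/and3P; split.
- by rewrite nthE // /cut big_pred0 // => k; rewrite ltn0 andbF.
- apply/forallP => k; apply/implyP; rewrite nthE // => kc.
  rewrite -leqn0 leqNgt; apply/negP => bk; move: kc.
  by rewrite leqNgt lt_cut // index_mem fps.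
apply/forallP => /= m; rewrite !nthE //; last exact: ltnW.
set e := tnth _ m.
have eps : e \in ps by apply: mem_tnth.
have eidx : index e ps = m.
  by rewrite /e (tnth_nth e) /= index_uniq // nz_uniq.
have blockE k : (0 < b k)%N -> (k \in block n (cut m) (cut m.+1)) = (f k == e).
  move=> bk; rewrite inE leqNgt !lt_cut // -leqNgt ltnS -eqn_leq -eidx.
  apply/eqP/eqP => [h|fk]; last by rewrite /idx fk.
  by rewrite -(nth_index e eps) h /idx nth_index ?fps.
(* Since [w e] is nonzero, its block contains a nonzero [b k], which makes the cuts strictly
   increasing. *)
have [k0 bk0 fk0] : exists2 k, (0 < b k)%N & f k = e.
  have : w e != 0%N by rewrite -lt0n -mem_nz.
  rewrite -hsum sum_nat_eq0 negb_forall => /existsP[k].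
  rewrite negb_imply => /andP[/eqP fk bk]; exists k => //.
  by move: bk; rewrite -lt0n subn_gt0; apply: leq_ltn_trans.
have := blockE k0 bk0; rewrite fk0 eqxx inE => /andP[ck0 k0c].
rewrite (leq_ltn_trans ck0 k0c) /=; apply/andP; split.
  apply: cut_le => k bk km; apply: leq_ltn_trans (hge k bk) _.
  rewrite ltnS leqNgt -(nz_index_lt eps) ?fps // eidx -leqNgt.
  by rewrite -ltnS.
apply/andP; split; last first.
  apply/forallP => k; apply/implyP => kB; apply/implyP => /andP[].
  rewrite -lt0n => bk hfirst; apply/negP => kR.
  have [k' k'k [bk' fk']] := hblack k kR.
  move/forallP: hfirst => /(_ k')/implyP.
  rewrite blockE // fk' -blockE // => /(_ kB)/implyP/(_ k'k)/eqP h.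
  by move: bk'; rewrite h.
rewrite (sum_black_red _ hpos) -hsum; apply/eqP; congr (_ + _)%N.
rewrite big_mkcond [RHS]big_mkcond; apply: eq_bigr => k _.
have [bk|] := posnP (b k); first by rewrite bk sub0n !if_same.
by move=> bk; rewrite blockE.
Qed.

Lemma cuts_between (cut : nat -> nat) m (k : nat) : (cut 0 <= k < cut m)%N ->
  exists2 j : 'I_m, (cut j <= k)%N & (k < cut j.+1)%N.
Proof.
case/andP=> h0; elim: m => [|m IH] hm; first by move: hm; rewrite ltnNge h0.
have [/IH[j hj hj']|] := ltnP k (cut m); last by exists ord_max.
by exists (widen_ord (leqnSn m) j).
Qed.

Lemma cuts_mono (cut : nat -> nat) m :
  (forall j : 'I_m, (cut j < cut j.+1)%N) ->
  forall s t, (s <= t)%N -> (t <= m)%N -> (cut s <= cut t)%N.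
Proof.
move=> h s; elim=> [|t IH]; first by rewrite leqn0 => /eqP->.
rewrite leq_eqVlt => /orP[/eqP->//|]; rewrite ltnS => st tm.
by apply: leq_trans (IH st (ltnW tm)) _; apply: ltnW (h (Ordinal tm)).
Qed.

Lemma is_glide_map w b R : is_glide w b R -> exists f, glide_map w b R f.
Proof.
set ps := nz_positions w.
case/andP=> /forallP hR /existsP[s]; 
pose cut m := nat_of_ord (nth ord0 s m).
have {}hR k : k \in R -> (0 < b k)%N by apply/implyP/hR.
rewrite /glide_cuts -/(cut _) => /and3P[/eqP cut0 /forallP hend /forallP hcut].
have hlt (j : 'I_(size ps)) : (cut j < cut j.+1)%N by have /and3P[] := hcut j.
have hge (j : 'I_(size ps)) : (cut j.+1 <= (tnth (in_tuple ps) j).+1)%N.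
  by have /and3P[] := hcut j.
have hbl (j : 'I_(size ps)) : glide_block w b R (tnth (in_tuple ps) j)
    (block n (cut j) (cut j.+1)) by have /and3P[] := hcut j.
have mono := cuts_mono hlt.
(* The default [k] is met only where [b] vanishes, since the blocks cover all nonzero positions. *)
pose f : {ffun 'I_n -> 'I_n} := [ffun k : 'I_n =>
  if [pick j : 'I_(size ps) | (cut j <= k < cut j.+1)%N] is Some j
  then tnth (in_tuple ps) j else k].
have inblock k : (0 < b k)%N -> exists2 j : 'I_(size ps),
    (cut j <= k < cut j.+1)%N & f k = tnth (in_tuple ps) j.
  move=> bk; have kend : (k < cut (size ps))%N.
    rewrite ltnNge; apply/negP => h; have := implyP (hend k) h.
    by move/eqP => h'; rewrite h' in bk.
  have [|j h1 h2] := @cuts_between cut (size ps) k; first by rewrite cut0.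
  rewrite ffunE; case: pickP => [j' hj'|/(_ j)]; last by rewrite h1 h2.
  by exists j'.
have block_lt (j j' : 'I_(size ps)) k k' : (cut j <= k < cut j.+1)%N ->
    (cut j' <= k' < cut j'.+1)%N -> (k <= k')%N -> (j <= j')%N.
  move=> /andP[h1 h2] /andP[h3 h4] kk'; rewrite leqNgt; apply/negP => jj'.
  have : (cut j'.+1 <= cut j)%N by apply: mono => //; apply: ltnW.
  by move: h1 h4 kk'; lia.
have tnth_le (j j' : 'I_(size ps)) : (j <= j')%N ->
    (tnth (in_tuple ps) j <= tnth (in_tuple ps) j')%N.
  rewrite leq_eqVlt => /orP[/eqP/ord_inj->//|jj'].
  have x0 : 'I_n := tnth (in_tuple ps) j; rewrite !(tnth_nth x0) ltnW //.
  by apply: nz_nth_lt; rewrite jj' ltn_ord.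
have tnth_inj (j j' : 'I_(size ps)) :
    tnth (in_tuple ps) j = tnth (in_tuple ps) j' -> j = j'.
  have x0 : 'I_n := tnth (in_tuple ps) j; rewrite !(tnth_nth x0) /= => /eqP.
  by rewrite nth_uniq ?nz_uniq // => /eqP/ord_inj.
have blockE (j : 'I_(size ps)) k : (0 < b k)%N ->
    (k \in block n (cut j) (cut j.+1)) = (f k == tnth (in_tuple ps) j).
  move=> bk; rewrite inE; have [j' hj' ->] := inblock k bk.
  apply/idP/eqP => [hj|/tnth_inj <-//]; congr (tnth _ _).
  by apply/ord_inj/eqP; rewrite eqn_leq (block_lt _ _ k k) ?(block_lt _ _ k k).
exists f; split=> //.
- move=> k k' /inblock[j hj ->] /inblock[j' hj' ->] kk'.
  by apply: tnth_le; apply: block_lt kk'.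
- move=> k /inblock[j /andP[_ hj] ->]; rewrite -ltnS.
  exact: leq_trans (hge j).
- move=> e; have [eps|neps] := boolP (e \in ps); last first.
    have -> : w e = 0%N by apply/eqP; rewrite -leqn0 leqNgt -mem_nz.
    rewrite big1 // => k /eqP fk; have [->//|bk] := posnP (b k).
    have [j _ fkj] := inblock k bk; case/negP: neps.
    by rewrite -fk fkj mem_tnth.
  have [j ej] : exists j : 'I_(size ps), e = tnth (in_tuple ps) j.
    by apply/tnthP.
  have /andP[/eqP hs _] := hbl j.
  have := hs; rewrite (sum_black_red _ hR) ej.
  rewrite (eq_card (B := R :&: block n (cut j) (cut j.+1))); last first.
    by move=> k; rewrite !inE.
  move/addIn => <-.
  rewrite big_mkcond [RHS]big_mkcond; apply: eq_bigr => k _.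
  have [bk|] := posnP (b k); first by rewrite bk sub0n !if_same.
  by move=> bk; rewrite blockE.
move=> k kR; have bk := hR k kR; have [j hj fk] := inblock k bk.
(* The least nonzero position of the block of [k] is black by the glide condition, hence lies
   strictly below the red [k]. *)
pose P x := (0 < b x)%N && (x \in block n (cut j) (cut j.+1)).
have Pk : P k by rewrite /P bk inE.
case: (@arg_minnP _ k P (fun x => x : nat) Pk) => x /andP[bx xB] xmin.
have /andP[_ /forallP/(_ x)/implyP/(_ xB)] := hbl j.
rewrite -lt0n bx /= => hx.
have /(implyP hx) xR : [forall k' in block n (cut j) (cut j.+1),
    (k' < x)%N ==> (b k' == 0%N)].
  apply/forallP => y; apply/implyP => yB; apply/implyP => yx.
  rewrite -leqn0 leqNgt; apply/negP => by0.
  by have := xmin y; rewrite /P by0 yB leqNgt yx => /(_ isT).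
exists x; last by split=> //; rewrite fk; apply/eqP; rewrite -blockE.
rewrite ltn_neqAle xmin // andbT; apply: contraNneq xR => /ord_inj ->.
exact: kR.
Qed.

End Glides.

Lemma interval_card (X : finType) (A : {set X}) (h : X -> nat) lo len :
  {in A &, injective h} -> (forall x, x \in A -> (lo <= h x < lo + len)%N) ->
  (forall m, (lo <= m < lo + len)%N -> exists2 x, x \in A & h x = m) ->
  #|A| = len.
Proof.
move=> hinj hA honto.
rewrite -(size_iota lo len) cardE -(size_map h); apply/perm_size/uniq_perm.
- by rewrite map_inj_in_uniq ?enum_uniq // => x y; rewrite !mem_enum; apply: hinj.
- exact: iota_uniq.
move=> m; rewrite mem_iota; apply/mapP/idP => [[x]|/honto[x xA <-]].
  by rewrite mem_enum => /hA + ->.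
by exists x; rewrite ?mem_enum.
Qed.

(** * From a glide of the weight of S back to a filling *)

Section GlideRefinement.

Variables (n : nat) (a : 'X_{1..n}).
Implicit Types (S T : filling a) (c d : cell a) (x y k e : 'I_n).
Implicit Types (f : {ffun 'I_n -> 'I_n}) (b : 'X_{1..n}) (R : {set 'I_n}).

Lemma coarsening_glide_map T f : coarsening T f ->
  (forall c x, x \in T c -> (x <= f x)%N) ->
  glide_map (wt (push T f)) (wt T) (red T f) f.
Proof.
move=> Tf hge; split.
- exact: red_sub.
- move=> x y; rewrite !wt_gt0 => /existsP[c xc] /existsP[d yd].
  exact: coarsening_le Tf xc yd.
- by move=> x; rewrite wt_gt0 => /existsP[c /hge].
- by move=> e; rewrite wt_push.
move=> k; rewrite inE => /existsP[c /redpairP[kc [x [xk fx xc]]]].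
by exists x => //; split=> //; rewrite wt_gt0; apply/existsP; exists c.
Qed.

Lemma glide_map_first w b R f k : glide_map w b R f -> (0 < b k)%N ->
  exists x, [/\ (x <= k)%N, x \notin R, (0 < b x)%N & f x = f k].
Proof.
case=> _ _ _ _ hblack bk.
have Pk : (0 < b k)%N && (f k == f k) by rewrite bk eqxx.
case: (@arg_minnP _ k (fun x => (0 < b x)%N && (f x == f k)) (fun x => x : nat) Pk).
move=> x /andP[bx /eqP fx] xmin; exists x; split=> //; first by rewrite xmin ?Pk.
apply/negP => /hblack[y yx [by0 fy]].
by have := xmin y; rewrite by0 fy fx eqxx leqNgt yx => /(_ isT).
Qed.

Lemma wsum_glide S b R f m : glide_map (wt S) b R f ->
  wsum S m = (\sum_(k | (f k < m)%N) (b k - (k \in R)))%N.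
Proof.
case=> _ _ _ hsum _; rewrite /wsum [RHS](partition_big f (fun e => (e < m)%N)) //=.
apply: eq_bigr => e em; rewrite -hsum; apply: eq_bigl => k.
by case: eqP => [->|]; rewrite ?em // andbF.
Qed.

(** The positions assigned to [k], with the extra one on the left when [k] is red, all belong to the
    value [f k] of [S]. This follows from monotonicity of [f], plus a smaller black position of the
    class when [k] is red. *)
Lemma glide_window S b R f k : glide_map (wt S) b R f -> (0 < b k)%N ->
  (wsum S (f k) + (k \in R) <= psum b R k)%N /\
  (psum b R k.+1 <= wsum S (f k) + wt S (f k))%N.
Proof.
move=> gm bk; have [hR hmono _ _ _] := gm.
rewrite -wsumS !(wsum_glide _ gm); split; last first.
  rewrite /psum big_mkcond [leqRHS]big_mkcond; apply: leq_sum => i _.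
  have [->|bi] := posnP (b i); first by rewrite sub0n !if_same.
  by rewrite !ltnS; case: (leqP i k) => // ik; rewrite hmono.
have below i : (0 < b i)%N -> (f i < f k)%N -> (i < k)%N.
  by move=> bi; apply: contraTltn => ki; rewrite -leqNgt hmono.
have [kR|_] := boolP (k \in R); last first.
  rewrite addn0 /psum big_mkcond [leqRHS]big_mkcond; apply: leq_sum => i _.
  have [->|bi] := posnP (b i); first by rewrite sub0n !if_same.
  by case: ifP => // /(below i bi)->.
(* The black [x] is below [k] and contributes at least 1 to [psum b R k], but is not counted among
   the positions with class below [f k]. *)
have [x [xk xR bx fx]] := glide_map_first gm bk.
have {}xk : (x < k)%N by rewrite ltn_neqAle xk andbT;
  apply: contraNneq xR => /ord_inj->.
rewrite /psum [leqRHS](bigD1 x) //= (negbTE xR) subn0 addnC leq_add //.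
rewrite big_mkcond [leqRHS]big_mkcond; apply: leq_sum => i _.
have [->|bi] := posnP (b i); first by rewrite sub0n !if_same.
case: ifP => // fik; rewrite (below i bi fik) /=.
by case: eqP => // eix; move: fik; rewrite eix fx ltnn.
Qed.

(** The intervals between consecutive values of [psum] tile all positions of [S]; [glide_window]
    then identifies the class of the tile containing the entry. *)
Lemma glide_cover S b R f c e : glide_map (wt S) b R f -> e \in S c ->
  exists k, [/\ f k = e, (0 < b k)%N, (psum b R k <= position S (e, c))%N &
                (position S (e, c) < psum b R k.+1)%N].
Proof.
move=> gm ec; have /andP[h1] := position_bounds ec; rewrite -wsumS => h2.
have [|k k1 k2] := @cuts_between (psum b R) n (position S (e, c)).
  rewrite psum0 (leq_trans h2) // (leq_trans (wsum_mono S (ltn_ord e))) //.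
  rewrite (wsum_glide _ gm) (eq_bigl (fun k : 'I_n => (k < n)%N)) // => k.
  by rewrite !ltn_ord.
have bk : (0 < b k)%N.
  have := leq_ltn_trans k1 k2; rewrite psumS -{1}[psum _ _ _]addn0 ltn_add2l.
  by rewrite subn_gt0; apply: leq_ltn_trans.
exists k; split=> //; have [w1 w2] := glide_window gm bk.
have w1' := leq_trans (leq_addr _ _) w1; rewrite -wsumS in w2.
apply/ord_inj/eqP; rewrite eqn_leq; apply/andP; split; rewrite leqNgt.
  apply/negP => /(wsum_mono S) h.
  by move: (leq_trans h2 (leq_trans h (leq_trans w1' k1))); rewrite ltnn.
apply/negP => /(wsum_mono S) h.
by move: (leq_trans k2 (leq_trans w2 (leq_trans h h1))); rewrite ltnn.
Qed.

Lemma glide_refinement S b R f : S1 S -> glide_map (wt S) b R f ->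
  exists T, [/\ coarsening T f, push T f = S, wt T = b, red T f = R &
                forall c x, x \in T c -> (x <= f x)%N].
Proof.
move=> S1S gm; have [hR hmono hge _ _] := gm.
(* Each value [k] is put into the boxes whose entry [f k] has its position in the interval of [k],
   extended by one to the left when [k] is red. *)
pose T : filling a := [ffun c => [set k : 'I_n |
  [&& (0 < b k)%N, f k \in S c,
      (psum b R k <= position S (f k, c) + (k \in R))%N &
      (position S (f k, c) < psum b R k.+1)%N]]].
have TP k c : reflect [/\ (0 < b k)%N, f k \in S c,
      (psum b R k <= position S (f k, c) + (k \in R))%N &
      (position S (f k, c) < psum b R k.+1)%N] (k \in T c).
  by rewrite ffunE inE; apply: and4P.
have cover e c : e \in S c -> exists k, [/\ k \in T c, f k = e &
    (psum b R k <= position S (e, c))%N].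
  move=> ec; have [k [fk bk h1 h2]] := glide_cover gm ec.
  exists k; split=> //; apply/TP; rewrite fk; split=> //.
  exact: leq_trans h1 (leq_addr _ _).
have Tf : coarsening T f.
  (* For merged [x < y], the entry in [c] comes no later than the one in [d]; as equal values are
     read from right to left, [c = d] or [d] is strictly left. *)
  apply/coarseningP => c d x y /TP[bx fx x1 x2] /TP[by0 fy y1 y2] xy.
  have := hmono x y bx by0 (ltnW xy); rewrite leq_eqVlt => /orP[/eqP/ord_inj e|->//].
  rewrite e ltnn eqxx /=; rewrite e in x2 fx.
  have := @prec_total _ a S (f y, c) (f y, d) S1S fx fy.
  rewrite /prec /= ltnn eqxx /= => -[[->]|->|h]; rewrite ?eqxx ?orbT //.
  have : (position S (f y, d) < position S (f y, c))%N.
    by apply: position_lt => //; rewrite /prec /= ltnn eqxx.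
  move: (psum_mono b R xy); case: (y \in R) y1 => /=; lia.
have wtT : wt T = b.
  apply/mnmP => k; rewrite wtE; have [bk|bk] := posnP (b k).
    rewrite bk; apply/eqP; rewrite cards_eq0; apply/eqP/setP => c.
    by rewrite !inE; apply/negP => /TP[]; rewrite bk.
  have psk : (psum b R k.+1 + (k \in R) = psum b R k + b k)%N.
    by rewrite psumS -addnA subnK //; have [/hR|] := boolP (k \in R).
  apply: (@interval_card _ _ (fun c => position S (f k, c) + (k \in R))%N
            (psum b R k)).
  - move=> c d; rewrite !inE => /TP[_ fc _ _] /TP[_ fd _ _] /addIn e.
    by have [] := @position_inj _ a S (f k, c) (f k, d) S1S fc fd e.
  - by move=> c; rewrite inE => /TP[_ _ -> h]; rewrite -psk ltn_add2r.
  (* After undoing the shift for red values, every position of the interval belongs to the value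
     [f k] of [S], so a box realizes it. *)
  move=> m /andP[m1 m2]; have [w1 w2] := glide_window gm bk.
  have [|c kc e] := @position_onto _ a S (f k) (m - (k \in R)) S1S.
    by move: psk; case: (k \in R) w1 => /=; lia.
  have me : (m - (k \in R) + (k \in R) = m)%N by rewrite subnK // (leq_trans
    _ m1) ?(leq_trans _ w1) ?leq_addl.
  exists c; last by rewrite e.
  rewrite inE; apply/TP; split=> //; rewrite e ?me //.
  by rewrite -(ltn_add2r (k \in R)) me psk.
exists T; split=> //.
- apply/ffunP => c; apply/setP => e; apply/idP/idP => [/push_inv[k]|].
    by case/TP=> _ fk _ _ ->.
  by case/cover=> k [kc <- _]; apply: mem_push.
- apply/setP => k; rewrite inE; apply/existsP/idP => [[c]|kR].
    case/redpairP=> /TP[bk fk k1 k2] [x [xk fx /TP[_ _ _ x2]]].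
    move: (psum_mono b R xk); rewrite fx in x2.
    by case: (k \in R) k1 => //; lia.
  have bk := hR k kR; have [w1 w2] := glide_window gm bk.
  have kk1 := psum_mono b R (leqnSn k).
  rewrite kR in w1.
  (* The position just before [psum b R k] is the shared one: [k] has it only through the extension,
     and [cover] supplies a smaller value of the same class in that box. *)
  have [|c kc e] := @position_onto _ a S (f k) (psum b R k).-1 S1S; first by lia.
  exists c; apply/redpairP; split.
    by apply/TP; split=> //; rewrite e ?kR; lia.
  have [x [xc fx x1]] := cover _ _ kc; exists x; split=> //.
  rewrite ltnNge; apply/negP => /(psum_mono b R) h.
  by move: (leq_trans h x1); rewrite e; lia.
- by move=> c x /TP[bx _ _ _]; apply: hge.
Qed.

End GlideRefinement.

(** * Fibres of destandardization *)

Section Destandardization.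

Variables (n : nat) (a : 'X_{1..n}).
Implicit Types (S T : filling a) (c d : cell a) (x y k e : 'I_n).
Implicit Types (f g : {ffun 'I_n -> 'I_n}) (b : 'X_{1..n}) (R : {set 'I_n}).

Definition dst_map T : {ffun 'I_n -> 'I_n} :=
  odflt [ffun x => x] [pick f : {ffun 'I_n -> 'I_n} |
    [&& coarsening T f, push T f \in Q2F a & [forall x : 'I_n, (x <= f x)%N]]].

Lemma dst_mapP T : T \in QSSF a ->
  [/\ coarsening T (dst_map T), push T (dst_map T) \in Q2F a &
      forall x, (x <= dst_map T x)%N].
Proof.
move=> TQ; rewrite /dst_map; case: pickP => [f /and3P[Tf fQ /forallP]|h].
  by split.
have [f [Tf fQ xf]] := exists_coarsening TQ.
have := h f; rewrite /= Tf fQ /= => /negP[]; exact/forallP.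
Qed.

Lemma eq_push T f g : (forall c x, x \in T c -> f x = g x) ->
  push T f = push T g.
Proof.
move=> fg; apply/ffunP => c; rewrite !ffunE; apply: eq_in_imset => x.
exact: fg.
Qed.

Lemma eq_red T f g : (forall c x, x \in T c -> f x = g x) -> red T f = red T g.
Proof.
move=> fg; apply/setP => k; rewrite !inE; apply: eq_existsb => c.
apply/redpairP/redpairP => -[kc [x [xk fx xc]]]; split=> //; exists x.
  by rewrite -(fg c x xc) -(fg c k kc).
by rewrite (fg c x xc) (fg c k kc).
Qed.

Lemma dst_map_unique T f : T \in QSSF a -> coarsening T f ->
  push T f \in Q2F a -> forall c x, x \in T c -> f x = dst_map T x.
Proof.
move=> TQ Tf fQ; have [Td dQ _] := dst_mapP TQ.
exact: coarsening_unique.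
Qed.

Lemma mdeg_wt T f : coarsening T f ->
  mdeg (wt T) = (mdeg (wt (push T f)) + #|red T f|)%N.
Proof.
move=> Tf; rewrite !mdegE (sum_black_red predT (@red_sub _ _ T f)); congr (_ + _)%N.
  rewrite [LHS](partition_big f predT) //=; apply: eq_bigr => e _.
  by rewrite wt_push.
by apply: eq_card => k; rewrite !inE andbT.
Qed.

Lemma mdeg_wt_ge T : is_filling T -> (mdeg a <= mdeg (wt T))%N.
Proof.
move=> /is_fillingP T0.
have -> : mdeg (wt T) = (\sum_(c : cell a) #|T c|)%N.
  rewrite mdegE; transitivity (\sum_k \sum_(c | k \in T c) 1)%N.
    by apply: eq_bigr => k _; rewrite sum1_card wtE cardsE.
  rewrite (exchange_big_dep predT) //=; apply: eq_bigr => c _.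
  by rewrite sum1_card.
have -> : mdeg a = (\sum_(c : cell a) 1)%N.
  rewrite sum1_card card_tagged sumnE big_map big_enum mdegE.
  by apply: eq_bigr => i _; rewrite card_ord.
by apply: leq_sum => c _; apply/card_gt0P; apply: T0.
Qed.

Lemma Q2F_QSSF S : S \in Q2F a -> S \in QSSF a.
Proof. by rewrite inE => /andP[]. Qed.

Lemma QSSF_filling S : S \in QSSF a -> is_filling S.
Proof. by rewrite QSSFE => /andP[]. Qed.

Lemma QSSF_S1 S : S \in QSSF a -> S1 S.
Proof. by rewrite QSSFE => /and3P[]. Qed.

(** [T] maps to ([wt T], [red T]), a bijection from the fibre onto the glides of [wt S]:
    [pull_unique] gives injectivity and [glide_refinement] surjectivity. The excess of [T] is |S| -
    |a| plus the number of red values. *)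
Lemma sum_dst_fibre S : S \in Q2F a ->
  \sum_(T in QSSF a | push T (dst_map T) == S)
     beta ^+ ex_filling T *: 'X_[wt T] =
  beta ^+ (mdeg (wt S) - mdeg a) *: glide_poly (wt S) :> {mpoly {poly int}[n]}.
Proof.
move=> SQ; have S1S := QSSF_S1 (Q2F_QSSF SQ).
have aS := mdeg_wt_ge (QSSF_filling (Q2F_QSSF SQ)).
set D := (mdeg (wt S) + n).+1.
pose A := [set T in QSSF a | push T (dst_map T) == S].
have AE T : (T \in A) = (T \in QSSF a) && (push T (dst_map T) == S).
  by rewrite [in LHS]inE.
(* The default [bm0] is not reached on the fibre, because |T| is at most |S| + n there. *)
pose h T : 'X_{1..n < D} * {set 'I_n} := (insubd bm0 (wt T), red T (dst_map T)).
have degT T : T \in A -> mdeg (wt T) = (mdeg (wt S) + #|red T (dst_map T)|)%N.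
  rewrite AE => /andP[TQ /eqP <-]; have [Td _ _] := dst_mapP TQ.
  exact: mdeg_wt.
have hval T : T \in A -> bmnm (h T).1 = wt T.
  move=> TA; rewrite /h /=; apply: insubdK.
  rewrite -[_ \in _]/(_ < _)%N /D ltnS degT // leq_add2l.
  by rewrite (leq_trans (max_card _)) // card_ord.
have hinj : {in A &, injective h}.
  move=> T T' TA TA' e; have ew : wt T = wt T' by rewrite -!hval // e.
  have er : red T (dst_map T) = red T' (dst_map T') by case: e.
  move: TA TA'; rewrite !AE => /andP[TQ /eqP eT] /andP[TQ' /eqP eT'].
  have [[Td _ _] [Td' _ _]] := conj (dst_mapP TQ) (dst_mapP TQ').
  exact: pull_unique Td Td' eT eT' ew er.
have himg : h @: A =
    [set p : 'X_{1..n < D} * {set 'I_n} | is_glide (wt S) p.1 p.2].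
  apply/setP => p; rewrite inE; apply/imsetP/idP => [[T TA ->]|].
    rewrite hval //=; move: TA; rewrite AE => /andP[TQ /eqP eT].
    have [Td _ dge] := dst_mapP TQ; rewrite -{1}eT.
    apply: (@glide_map_is_glide _ _ _ _ (dst_map T)).
    by apply: coarsening_glide_map.
  move=> /is_glide_map[f gm].
  have [T [Tf eT ew er tge]] := glide_refinement S1S gm.
  have fQ : push T f \in Q2F a by rewrite eT.
  have TQ : T \in QSSF a by apply: QSSF_pull (Q2F_QSSF fQ) Tf tge.
  (* The map [f] read off from the glide agrees with [dst_map T] on the entries of [T]; so [T] is in
     the fibre of [S] and both maps give the same red set. *)
  have uni := dst_map_unique TQ Tf fQ.
  have TA : T \in A by rewrite AE TQ -(eq_push uni) eT eqxx.
  exists T => //; case: p ew er {gm} => b R /= ew er.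
  congr (_, _); last by rewrite -er; apply: eq_red.
  by apply/val_inj; exact: esym (etrans (hval T TA) ew).
rewrite (eq_bigl (mem A)); last by move=> T; rewrite /= AE.
rewrite /glide_poly scaler_sumr.
under [RHS]eq_bigr => b _ do rewrite scaler_sumr.
rewrite pair_big_dep /=.
rewrite [RHS](eq_bigl (mem (h @: A))); last by move=> p; rewrite himg /= inE.
rewrite big_imset //=; apply: eq_bigr => T TA.
rewrite -/(h T) -/((h T).1) hval // scalerA -exprD /ex_filling degT //.
by rewrite addnBAC.
Qed.

Lemma sum_QSSF :
  \sum_(T in QSSF a) beta ^+ ex_filling T *: 'X_[wt T] =
  \sum_(S in Q2F a) beta ^+ (mdeg (wt S) - mdeg a) *: glide_poly (wt S)
  :> {mpoly {poly int}[n]}.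
Proof.
rewrite (partition_big (fun T => push T (dst_map T)) (mem (Q2F a))) /=.
  by apply: eq_bigr => S; apply: sum_dst_fibre.
by move=> T /dst_mapP[].
Qed.

End Destandardization.

(** * Compositions with the same positive part *)

Section RowIso.

Variable n : nat.
Implicit Types (a b : 'X_{1..n}) (i j k : 'I_n) (s : 'I_n -> 'I_n).

(** An order-preserving matching of the nonempty rows, equivalent to equality of positive parts; the
    values of [s] at empty rows are arbitrary. *)
Record row_iso a b s : Prop := RowIso {
  row_iso_mono : forall i j, (0 < a i)%N -> (0 < a j)%N ->
    (i < j)%N -> (s i < s j)%N;
  row_iso_len : forall i, (0 < a i)%N -> b (s i) = a i;
  row_iso_onto : forall j, (0 < b j)%N -> exists2 i, (0 < a i)%N & s i = j }.

Lemma row_iso_nz a b s : row_iso a b s ->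
  nz_positions b = [seq s i | i <- nz_positions a].
Proof.
case=> hmono hlen honto.
have tr : transitive (fun i j => (i < j)%N) by move=> j i k; apply: ltn_trans.
apply: (irr_sorted_eq tr _ (nz_sorted b)); first by move=> i; rewrite ltnn.
  apply: (homo_sorted_in (P := mem (nz_positions a))) (nz_sorted a).
    by move=> i j; rewrite /= !mem_nz; apply: hmono.
  exact/allP.
move=> j; rewrite mem_nz; apply/idP/mapP => [/honto[i ai <-]|[i]].
  by exists i; rewrite ?mem_nz.
by rewrite mem_nz => ai ->; rewrite hlen.
Qed.

Lemma pos_partE a : pos_part a = [seq a i | i <- nz_positions a].
Proof. by rewrite /pos_part filter_map. Qed.

Lemma row_iso_pos_part a b s : row_iso a b s -> pos_part b = pos_part a.
Proof.
move=> ri; rewrite !pos_partE (row_iso_nz ri) -map_comp; apply/eq_in_map => i.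
by rewrite mem_nz; apply: row_iso_len ri i.
Qed.

Lemma row_iso_unique a b s s' i : row_iso a b s -> row_iso a b s' ->
  (0 < a i)%N -> s i = s' i.
Proof.
move=> /row_iso_nz e /row_iso_nz e' ai.
by have /eq_in_map -> // := etrans (esym e) e'; rewrite mem_nz.
Qed.

Lemma pos_part_row_iso a b : pos_part b = pos_part a ->
  exists s, row_iso a b s.
Proof.
rewrite !pos_partE => e.
have esz : size (nz_positions b) = size (nz_positions a).
  by rewrite -(size_map b) e size_map.
exists (fun i => nth i (nz_positions b) (index i (nz_positions a))); split.
- move=> i j; rewrite -!mem_nz => ia ja ij.
  rewrite (set_nth_default j i) ?esz ?index_mem // nz_nth_lt // esz index_mem.
  by rewrite ja andbT nz_index_lt.
- move=> i; rewrite -mem_nz => ia.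
  rewrite -(nth_map i 0%N) ?esz ?index_mem // e.
  by rewrite (nth_map i) ?index_mem // nth_index.
move=> j; rewrite -mem_nz => jb.
have jz : (index j (nz_positions b) < size (nz_positions a))%N.
  by rewrite -esz index_mem.
exists (nth j (nz_positions a) (index j (nz_positions b))).
  by rewrite -mem_nz mem_nth.
rewrite index_uniq ?nz_uniq // (set_nth_default j) ?esz //.
by rewrite nth_index.
Qed.

Lemma nz_sum a (P : pred 'I_n) :
  (\sum_(i | P i) a i = \sum_(i <- nz_positions a | P i) a i)%N.
Proof.
rewrite big_filter_cond big_enum_cond /= [LHS]big_mkcond [RHS]big_mkcond.
by apply: eq_bigr => i _; case: eqP => [->|]; rewrite //= if_same.
Qed.

Lemma row_iso_sum a b s (P : pred 'I_n) : row_iso a b s ->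
  (\sum_(j | P j) b j = \sum_(i | (0 < a i) && P (s i)) a i)%N.
Proof.
move=> ri; rewrite nz_sum (row_iso_nz ri) big_map big_filter_cond big_enum_cond.
rewrite (eq_bigl (fun i => (0 < a i)%N && P (s i))); last first.
  by move=> i; rewrite lt0n.
by apply: eq_bigr => i /andP[/(row_iso_len ri)].
Qed.

Lemma mdeg_row_iso a b s : row_iso a b s -> mdeg b = mdeg a.
Proof.
move=> ri; rewrite !mdegE (row_iso_sum predT ri) big_mkcond.
by apply: eq_bigr => i _; case: posnP => //= ->.
Qed.

(** Moving rows weakly down can only increase partial sums. Conversely, if [s i > i], only rows
    strictly below [i] land in rows up to [i], so the partial sum of [b] at [i] misses the positive
    [a i]. *)
Lemma row_iso_wc_ge a b s : row_iso a b s ->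
  reflect (forall i, (0 < a i)%N -> (s i <= i)%N) (wc_ge b a).
Proof.
move=> ri; have [hmono _ _] := ri.
apply: (iffP forallP) => [h i ai | h k]; last first.
  rewrite (row_iso_sum _ ri) big_mkcond [leqRHS]big_mkcond; apply: leq_sum => i _.
  case: (posnP (a i)) => [->|ai]; first by rewrite !if_same.
  by case: ifP => // ik; rewrite (leq_trans (h i ai)).
rewrite leqNgt; apply/negP => isi; have := h i; apply/negP; rewrite -ltnNge.
rewrite (row_iso_sum _ ri) [X in (_ < X)%N](bigD1 i) //= -[X in (X < _)%N]add0n.
rewrite -addSn leq_add // big_mkcond [leqRHS]big_mkcond; apply: leq_sum => j _.
case: ifP => // /andP[aj sji]; have ji : (j < i)%N.
  rewrite ltnNge leq_eqVlt; apply/negP => /orP[/eqP/ord_inj e|/(hmono i j ai aj) h'].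
    by move: sji isi; rewrite -e leqNgt => /negP h1 /h1.
  by have := leq_trans h' (leq_trans sji (ltnW isi)); rewrite ltnn.
by rewrite (ltnW ji) -(inj_eq val_inj) /= neq_ltn ji.
Qed.

End RowIso.

(** * Transport of fillings along a matching of rows *)

Section Transport.

Variable n : nat.
Implicit Types (a b : 'X_{1..n}).

(** This is all the geometry that (S.1)-(S.4) see: columns, the order of the rows and, for the
    triples, the row lengths. *)
Record cell_iso a b (t : cell a -> cell b) (g : cell b -> cell a) : Prop :=
  CellIso {
    cell_isoK : cancel t g;
    cell_isoVK : cancel g t;
    cell_iso_col : forall c, col (t c) = col c;
    cell_iso_row : forall c d, (row (t c) < row (t d))%N = (row c < row d)%N;
    cell_iso_len : forall c, b (row (t c)) = a (row c) }.

Lemma cell_iso_sym a b t g : @cell_iso a b t g -> cell_iso g t.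
Proof.
case=> tK gK hcol hrow hlen; split=> //.
- by move=> c; rewrite -hcol gK.
- by move=> c d; rewrite -hrow !gK.
- by move=> c; rewrite -hlen gK.
Qed.

Definition transport a b (t : cell a -> cell b) (F : filling b) : filling a :=
  [ffun c => F (t c)].

Variables (a b : 'X_{1..n}) (t : cell a -> cell b) (g : cell b -> cell a).
Hypothesis tg : cell_iso t g.
Implicit Types (F : filling b).

Let tK := cell_isoK tg.
Let gK := cell_isoVK tg.

Lemma transportK F : transport g (transport t F) = F.
Proof. by apply/ffunP => c; rewrite !ffunE gK. Qed.

Lemma transport_anchor F c : anchor (transport t F) c = anchor F (t c).
Proof. by rewrite /anchor ffunE. Qed.

Lemma transport_mem F c x : (x \in transport t F c) = (x \in F (t c)).
Proof. by rewrite ffunE. Qed.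

Lemma transport_adjacent l r : adjacent (t l) (t r) = adjacent l r.
Proof.
rewrite /adjacent !(cell_iso_col tg); congr (_ && _).
by rewrite -!(inj_eq val_inj) /= !eqn_leq ![(row _ <= _)%N]leqNgt !(cell_iso_row tg).
Qed.

Lemma transport_filling F : is_filling F -> is_filling (transport t F).
Proof.
move=> /is_fillingP h; apply/is_fillingP => c; have [x xc] := h (t c).
by exists x; rewrite transport_mem.
Qed.

Lemma transport_S1 F : S1 F -> S1 (transport t F).
Proof.
move=> /S1P h; apply/S1P => c d x ecd; rewrite !transport_mem => xc xd.
by apply: (can_inj tK); apply: (h _ _ x) => //; rewrite !(cell_iso_col tg).
Qed.

Lemma transport_S2 F : S2 F -> S2 (transport t F).
Proof.
move=> /S2P h; apply/S2P => l r x y adj; rewrite !transport_mem.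
by apply: h; rewrite transport_adjacent.
Qed.

Lemma transport_S3 F : S3 F -> S3 (transport t F).
Proof.
move=> /S3P h; apply/S3P => l r u hyp; rewrite !transport_anchor; apply: h.
move: hyp; rewrite /typeA /typeB transport_adjacent !(cell_iso_col tg).
by rewrite !(cell_iso_row tg) !(cell_iso_len tg).
Qed.

Lemma transport_fits F x d : fits (transport t F) x d -> fits F x (t d).
Proof.
move=> /fitsP[h1 h2]; apply/fitsP; split=> r y.
  rewrite -[r]gK transport_adjacent => adj yr.
  by apply: (h1 _ _ adj); rewrite transport_mem.
rewrite -[r]gK transport_adjacent => adj yr.
by apply: (h2 _ _ adj); rewrite transport_mem.
Qed.

Lemma transport_S4 F : S2 F -> S4 F -> S4 (transport t F).
Proof.
move=> F2 /(S4P F2) h; apply/(S4P (transport_S2 F2)) => c d x.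
rewrite transport_mem !transport_anchor => xc nx edc ndc xd fit.
apply: (h _ _ x) => //; first by rewrite !(cell_iso_col tg).
  by rewrite (can_eq tK).
exact: transport_fits.
Qed.

Lemma transport_wt F : wt (transport t F) = wt F.
Proof.
apply/mnmP => i; rewrite !wtE -(card_imset _ (can_inj tK)); apply: eq_card => c.
rewrite inE; apply/imsetP/idP => [[d]|ic].
  by rewrite inE transport_mem => + ->.
by exists (g c); rewrite ?inE ?transport_mem gK.
Qed.

End Transport.

(** * The quasiLascoux polynomial as a sum over quasi-skyline fillings *)

Section QuasiLascoux.

Variable n : nat.
Implicit Types (a b : 'X_{1..n}) (i j k : 'I_n) (s : 'I_n -> 'I_n).

Lemma row_gt0 a (c : cell a) : (0 < a (row c))%N.
Proof. by case: c => i [m /= hm]; apply: leq_ltn_trans hm. Qed.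

Lemma row_iso_cells a b s : row_iso a b s ->
  exists t g, @cell_iso n a b t g /\ forall c, row (t c) = s (row c).
Proof.
case=> hmono hlen honto.
pose t (c : cell a) : cell b := Tagged (fun i => 'I_(b i))
  (cast_ord (esym (hlen (row c) (row_gt0 c))) (tagged c)).
have trow c : row (t c) = s (row c) by [].
have tcol c : col (t c) = col c by [].
have trowlt c d : (row (t c) < row (t d))%N = (row c < row d)%N.
  rewrite !trow; case: (ltngtP (row c) (row d)) => [h|h|/ord_inj->].
  - by rewrite hmono ?row_gt0.
  - by apply/negbTE; rewrite -leqNgt ltnW // hmono ?row_gt0.
  - by rewrite ltnn.
have tinj : injective t.
  move=> c d e; apply: cell_eq; last by rewrite -!tcol e.
  apply/ord_inj/eqP; rewrite eqn_leq ![(row _ <= row _)%N]leqNgt -!trowlt e.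
  by rewrite !ltnn.
have tsurj d : exists c, t c == d.
  have [i ai si] := honto (row d) (row_gt0 d).
  have hj : (col d < a i)%N by rewrite -(hlen i ai) si; apply: ltn_ord.
  exists (Tagged (fun i => 'I_(a i)) (Ordinal hj)).
  by apply/eqP/cell_eq; rewrite ?trow ?tcol.
pose g d := xchoose (tsurj d).
have gK : cancel g t by move=> d; apply/eqP/(xchooseP (tsurj d)).
have tK : cancel t g by move=> c; apply: tinj; rewrite gK.
exists t, g; split=> //; split=> // c.
by rewrite trow hlen ?row_gt0.
Qed.

(** For a filling, the default [i] is taken at empty rows only, where [row_iso] imposes nothing. *)
Definition start_anchor a (T : filling a) i : 'I_n :=
  odflt i [pick x : 'I_n | [exists c,
    [&& row c == i, col c == 0%N & anchor T c == x]]].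

Lemma start_anchorE a (T : filling a) c : is_filling T -> col c = 0%N ->
  start_anchor T (row c) = anchor T c :> nat.
Proof.
move=> T0 c0; rewrite /start_anchor; case: pickP => [x /existsP[d]|h].
  case/and3P=> /eqP rd /eqP d0 /eqP <-; congr anchor.
  by apply: cell_eq; rewrite // d0.
have [u uc eu] := anchor_mem c T0.
have /negbT/negP[] := h u; apply/existsP; exists c.
by rewrite c0 eu !eqxx.
Qed.

(* The weak composition b whose atom contains the image of T under the
   bijection that moves each row of T to the row of its first anchor. *)
Definition anchor_shape a (T : filling a) : 'X_{1..n} :=
  [multinom (\sum_(i | (0 < a i)%N && (start_anchor T i == j)) a i)%N | j < n].

Lemma start_cell a i : (0 < a i)%N -> exists2 c : cell a, row c = i & col c = 0%N.
Proof. by move=> ai; exists (Tagged (fun i => 'I_(a i)) (Ordinal ai)). Qed.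

Lemma anchor_shape_iso a (T : filling a) : T \in QSSF a ->
  row_iso a (anchor_shape T) (start_anchor T) /\
  forall i, (0 < a i)%N -> (start_anchor T i <= i)%N.
Proof.
move=> TQ; have T0 := QSSF_filling TQ.
move: TQ; rewrite QSSFE => /and5P[_ _ _ _ /andP[_ /S5'P[T5 T5']]].
have mono i j : (0 < a i)%N -> (0 < a j)%N -> (i < j)%N ->
    (start_anchor T i < start_anchor T j)%N.
  move=> /start_cell[c <- c0] /start_cell[d <- d0] cd.
  by rewrite !start_anchorE // T5'.
split; last by move=> i /start_cell[c <- c0]; rewrite start_anchorE // T5.
split=> // [i ai|j].
  rewrite mnmE (big_pred1 i) // => k /=.
  apply/andP/eqP => [[ak /eqP e]|->]; last by rewrite ai eqxx.
  have [ik|ki|/ord_inj->//] := ltngtP i k.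
    by have := mono _ _ ai ak ik; rewrite e ltnn.
  by have := mono _ _ ak ai ki; rewrite e ltnn.
rewrite mnmE lt0n sum_nat_eq0 negb_forall => /existsP[i].
by rewrite negb_imply => /andP[/andP[ai /eqP e] _]; exists i.
Qed.

Lemma ASSFE b (F : filling b) : (F \in ASSF b) =
  [&& is_filling F, S1 F, S2 F, S3 F, S4 F & S5 F].
Proof. by rewrite inE. Qed.

Lemma S5P b (F : filling b) :
  reflect (forall c, col c = 0%N -> anchor F c = row c) (S5 F).
Proof.
apply: (iffP forallP) => h c; first by move=> /eqP c0; apply/eqP/(implyP (h c)).
by apply/implyP => /eqP /h ->.
Qed.

(** Moving rows along [s] identifies [ASSF b] with the quasi-skyline fillings of anchor shape [b]:
    under (S.5) the first anchor of row [i] becomes [s i], and (S.5') holds because [s] is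
    increasing with [s i <= i]. *)
Lemma sum_atom a b s : row_iso a b s ->
  (forall i, (0 < a i)%N -> (s i <= i)%N) ->
  lascoux_atom b =
  \sum_(T in QSSF a | anchor_shape T == b) beta ^+ ex_filling T *: 'X_[wt T].
Proof.
move=> ri sle; have [t [g [tg trow]]] := row_iso_cells ri.
have gt := cell_iso_sym tg; have [hmono _ _] := ri.
have tinj : {in ASSF b &, injective (transport t)}.
  by move=> F F' _ _ e; rewrite -(transportK tg F) e (transportK tg).
have im : transport t @: ASSF b =
    [set T : filling a | (T \in QSSF a) && (anchor_shape T == b)].
  apply/setP => T; rewrite [in RHS]inE; apply/imsetP/idP => [[F]|/andP[TQ /eqP eb]].
    rewrite ASSFE => /and5P[F0 F1 F2 F3 /andP[F4 /S5P F5]] ->.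
    have anc c : col c = 0%N -> anchor (transport t F) c = s (row c).
      by move=> c0; rewrite transport_anchor F5 ?trow // (cell_iso_col tg).
    have TQ : transport t F \in QSSF a.
      rewrite QSSFE (transport_filling _ F0) (transport_S1 tg F1).
      rewrite (transport_S2 tg F2) (transport_S3 tg F3) (transport_S4 tg F2 F4).
      apply/S5'P; split=> [c c0|c d c0 d0 cd]; first by rewrite anc ?sle ?row_gt0.
      by rewrite !anc // hmono ?row_gt0.
    rewrite TQ; apply/eqP/mnmP => j; rewrite mnmE.
    have -> : b j = (\sum_(k | k == j) b k)%N by rewrite big_pred1_eq.
    rewrite (row_iso_sum _ ri); apply: eq_bigl => i.
    case: posnP => //= /start_cell[c <- c0]; congr (_ == _); apply/ord_inj.
    by rewrite start_anchorE ?anc // (QSSF_filling TQ).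
  (* Both [s] and [start_anchor T] match the rows of [a] with those of [b], so they agree on
     nonempty rows; this yields (S.5) after transport. *)
  have [si _] := anchor_shape_iso TQ; rewrite eb in si.
  move: (TQ); rewrite QSSFE => /and5P[T0 T1 T2 T3 /andP[T4 _]].
  exists (transport g T); last by rewrite (transportK gt).
  rewrite ASSFE (transport_filling _ T0) (transport_S1 gt T1).
  rewrite (transport_S2 gt T2) (transport_S3 gt T3) (transport_S4 gt T2 T4) /=.
  apply/S5P => d d0; rewrite transport_anchor.
  have c0 : col (g d) = 0%N by rewrite (cell_iso_col gt).
  rewrite -(start_anchorE T0 c0) -(row_iso_unique ri si) ?row_gt0 // -trow.
  by rewrite (cell_isoVK tg).
rewrite [RHS](eq_bigl (mem (transport t @: ASSF b))); last first.
  by move=> T; rewrite im /= [in RHS]inE.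
rewrite big_imset //= /lascoux_atom; apply: eq_bigr => F _.
by rewrite /ex_filling (transport_wt tg) (mdeg_row_iso ri).
Qed.

(** Splits the fillings by [anchor_shape]. The index conditions on [b] hold since rows move weakly
    down to their first anchors, and the degree of the shape is |a|, so the default of [insubd] is
    not taken. *)
Lemma quasiLascoux_QSSF a :
  quasiLascoux a = \sum_(T in QSSF a) beta ^+ ex_filling T *: 'X_[wt T].
Proof.
have shape_deg (T : filling a) : T \in QSSF a ->
    bmnm (insubd (bm0 : 'X_{1..n < (mdeg a).+1}) (anchor_shape T)) = anchor_shape T.
  move=> /anchor_shape_iso[ri _]; apply: insubdK.
  by rewrite -[_ \in _]/(_ < _)%N (mdeg_row_iso ri) ltnSn.
rewrite [RHS](partition_big
  (fun T => insubd (bm0 : 'X_{1..n < (mdeg a).+1}) (anchor_shape T))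
  (fun b : 'X_{1..n < (mdeg a).+1} =>
     wc_ge b a && (pos_part b == pos_part a))) /=; last first.
  move=> T TQ; rewrite shape_deg //; have [ri sle] := anchor_shape_iso TQ.
  by rewrite (row_iso_pos_part ri) eqxx andbT; apply/(row_iso_wc_ge ri).
apply: eq_bigr => b /andP[ba /eqP /pos_part_row_iso[s ri]].
rewrite (sum_atom ri (row_iso_wc_ge ri ba)); apply: eq_bigl => T.
have [TQ|] := boolP (T \in QSSF a); last by [].
by rewrite bmeqP shape_deg.
Qed.

End QuasiLascoux.

(** * Assembling the expansion and grouping it by weight *)

Theorem theorem4p12 (n : nat) (hn : (1 <= n)%N) (a : 'X_{1..n}) :
  quasiLascoux a =
    \sum_(S in Q2F a) beta ^+ (mdeg (wt S) - mdeg a) *: glide_poly (wt S)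
  /\
  (exists (s : seq 'X_{1..n}) (c : 'X_{1..n} -> {poly int}),
     [/\ uniq s,
         (forall b, b \in s -> c b != 0 /\ c b \is a polyOver Num.nat) &
         quasiLascoux a = \sum_(b <- s) c b *: glide_poly b]).
Proof.
have main := etrans (quasiLascoux_QSSF a) (sum_QSSF a); split=> //.
(* Fillings of equal weight are collected. Only weights that occur are listed, so the multiplicity
   [N b] is positive and the coefficient is a nonzero monomial in [beta]. *)
pose N b := #|[set T in Q2F a | wt T == b]|.
exists (undup [seq wt T | T in Q2F a]),
  (fun b => (beta ^+ (mdeg b - mdeg a)) *+ N b); split.
- exact: undup_uniq.
- move=> b; rewrite mem_undup => /imageP[T TQ eb]; split.
    rewrite -mulr_natr mulf_neq0 ?expf_neq0 ?polyX_eq0 //.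
    rewrite -polyC_natr polyC_eq0 pnatr_eq0 -lt0n.
    by apply/card_gt0P; exists T; rewrite inE TQ eb eqxx.
  apply/polyOverP => i.
  by rewrite /= coefMn /beta coefXn -mulrnA natr_nat.
rewrite main; set r := undup _.
transitivity (\sum_(b <- r) \sum_(T in Q2F a | wt T == b)
                beta ^+ (mdeg (wt T) - mdeg a) *: glide_poly (wt T)).
  rewrite (exchange_big_dep (mem (Q2F a))) /=; last by move=> b T _ /andP[].
  apply: eq_bigr => T TQ; rewrite (eq_bigl (pred1 (wt T))); last first.
    by move=> b /=; rewrite TQ eq_sym.
  rewrite -big_filter filter_pred1_uniq ?undup_uniq ?big_seq1 //.
  by rewrite mem_undup; apply/imageP; exists T.
apply: eq_bigr => b _; rewrite /N -scalerMnl -sumr_const.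
apply: eq_big => [T|T /andP[_ /eqP->]//]; by rewrite inE.
Qed.
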